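(* There exists a constant $C$ such that the following holds. Let $0<p\le 1/2$, let $n,k$ be positive integers with $pn$ an integer, and let $f\colon \binom{[n]}{pn}\to\{0,1\}$ satisfy $\|f^{>k}\|_2^2\le \varepsilon\le p^{Ck}$. Then there is a function $\tilde f\colon \binom{[n]}{pn}\to\{0,1\}$ of degree at most $k$ such that $\Pr_x[f(x)\neq \tilde f(x)]\le 2\varepsilon$, where $x$ is uniform on $\binom{[n]}{pn}$.
   Context: The slice is $\binom{[n]}{pn}=\{x\in\{0,1\}^n:\sum_i x_i=pn\}$, endowed with the uniform probability measure; norms and inner products of functions on it are $\|f\|_2^2=\mathbb{E}_x[f(x)^2]$, $\langle f,g\rangle=\mathbb{E}_x[f(x)g(x)]$ with $x$ uniform on the slice. For $T\subseteq[n]$ let $\mathrm{AND}_T(x)=\prod_{i\in T}x_i$. Let $L_k$ be the span (in the space of real functions on the slice) of $\{\mathrm{AND}_T : |T|\le k\}$; a function has degree at most $k$ if it lies in $L_k$. The level-$d$ part $f^{=d}$ is the orthogonal projection of $f$ onto $L_d\cap L_{d-1}^{\perp}$ (with $L_{-1}=\{0\}$), and $f^{>k}=\sum_{d>k}f^{=d}$, i.e. $f$ minus its orthogonal projection onto $L_k$. (This coincides with the degree in the unique harmonic multilinear polynomial representation of $f$.) *)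

(* Defs.v *)
From HB Require Import structures.
From mathcomp Require Import all_boot all_order all_algebra.
From mathcomp Require Import reals exp.

Set Implicit Arguments.
Unset Strict Implicit.
Unset Printing Implicit Defensive.

Import Order.TTheory GRing.Theory Num.Theory.
Local Open Scope ring_scope.

Definition slice (n m : nat) : finType :=
  {x : {ffun 'I_n -> bool} | (\sum_(i < n) x i == m)%N}.

(* [R^o] rather than [R] so that this is a finite-dimensional vector space
   over R. *)
Notation slice_fun R n m := {ffun slice n m -> R^o}.

Section Slice.
Variables (R : realType) (n m : nat).
Implicit Types (f g h : slice_fun R n m) (U V : {vspace slice_fun R n m}).

Definition expect (X : slice n m -> R) : R :=
  (\sum_(x : slice n m) X x) / #|{: slice n m}|%:R.

Definition prob (A : pred (slice n m)) : R :=
  #|A|%:R / #|{: slice n m}|%:R.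

Definition inner f g : R := expect (fun x => f x * g x).

Definition norm2_sq f : R := expect (fun x => f x ^+ 2).

Definition AND (T : {set 'I_n}) : slice_fun R n m :=
  [ffun x : slice n m => \prod_(i in T) (val x i)%:R].

Definition L (k : nat) : {vspace slice_fun R n m} :=
  <<[seq AND T | T : {set 'I_n} in [pred T : {set 'I_n} | (#|T| <= k)%N]]>>%VS.

(* Orthogonality to U is tested on a basis of U. *)
Definition orthv U : {vspace slice_fun R n m} :=
  (\bigcap_(i < \dim U) lker (linfun (inner (vbasis U)`_i : _ -> R^o)))%VS.

(* [daddv_pi U V] is the projection onto U along V. *)
Definition orth_proj U f : slice_fun R n m := daddv_pi U (orthv U) f.

Definition L_prev (d : nat) : {vspace slice_fun R n m} :=
  if d is e.+1 then L e else 0%VS.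

Definition level_part (d : nat) f : slice_fun R n m :=
  orth_proj (L d :&: orthv (L_prev d)) f.

(* The sum over all d > k; levels d > n vanish because L d = L n there. *)
Definition above (k : nat) f : slice_fun R n m :=
  \sum_(k.+1 <= d < n.+1) level_part d f.

Definition degree_le (k : nat) f : Prop := f \in L k.

Definition real_of_bool_fun (f : slice n m -> bool) : slice_fun R n m :=
  [ffun x : slice n m => (f x)%:R].

End Slice.

(* Main.v *)
(** Let P be the projection onto L_k. Hypercontractivity (a function u of degree
    at most k satisfies E[u^4] <= p^(-O(k)) E[u^2]^2) makes the low-degree part of
    an integer-valued function r of norm at most p^(O(k)) negligible, so that
    E[r^2] <= 2 E[(r - P r)^2]. Hence an integer-valued w which is almost of degree k
    and only roughly close to an integer-valued W of degree k is automatically very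
    close to W, and W is unique: errors do not accumulate.

    W is found by downward induction on the number of disjoint transpositions in
    u = (1 - t_1) ... (1 - t_l) f. For l = k + 1 the function u is close to 0. For
    smaller l, u - g u has an approximation h_g for every transposition g of the
    remaining coordinates, hence, as errors do not accumulate, for every g in the
    group G they generate; by uniqueness h is a cocycle, so that
    F = avg_g h_g satisfies F - g F = h_g, while u - F is close to the G-invariant
    function avg_g g u. Adding to F a multiple of prod (x_i - x_j) over the l
    transposed pairs (i j) makes it integer-valued.

    Hypercontractivity for an eigenfunction v of the Laplacian Lap = sum_ij (1 - (i j)),
    of eigenvalue c, follows by induction on the degree from the identity
    2 c E[v^4] = sum_ij E[(1 - (i j)) v^3 (1 - (i j)) v]: the functions (1 - (i j)) v
    are eigenfunctions of the Laplacian of the other coordinates and the factor c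
    cancels. *)

Require Import Defs.
From HB Require Import structures.
From mathcomp Require Import all_boot all_order all_fingroup all_algebra.
From mathcomp Require Import reals exp.
From mathcomp Require Import ring lra zify.

Set Implicit Arguments.
Unset Strict Implicit.
Unset Printing Implicit Defensive.

Import Order.TTheory GRing.Theory Num.Theory.
Local Open Scope ring_scope.

(** * Permutations of the coordinates *)

Section Action.
Variables (n m : nat).
Implicit Types (x y : slice n m) (g h : 'S_n).

Lemma perm_slice_subproof g x :
  (\sum_(i < n) [ffun i => val x (g i)] i == m)%N.
Proof.
under eq_bigr do rewrite ffunE.
by rewrite -[eqbRHS](eqP (valP x)) [X in _ == X](reindex_inj (@perm_inj _ g)).
Qed.

Definition perm_slice g x : slice n m :=
  exist _ [ffun i => val x (g i)] (perm_slice_subproof g x).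

Lemma perm_sliceE g x i : val (perm_slice g x) i = val x (g i).
Proof. by rewrite ffunE. Qed.

Lemma slice_eqP x y : (forall i, val x i = val y i) -> x = y.
Proof. by move=> e; apply/val_inj/ffunP. Qed.

Lemma perm_slice1 x : perm_slice 1%g x = x.
Proof. by apply: slice_eqP => i; rewrite perm_sliceE perm1. Qed.

Lemma perm_sliceM g h x :
  perm_slice (g * h)%g x = perm_slice g (perm_slice h x).
Proof. by apply: slice_eqP => i; rewrite !perm_sliceE permM. Qed.

Lemma perm_slice_inj g : injective (perm_slice g).
Proof.
by apply: (can_inj (g := perm_slice g^-1)) => x; rewrite -perm_sliceM mulVg perm_slice1.
Qed.

Lemma perm_slice_tperm_id i j x :
  val x i = val x j -> perm_slice (tperm i j) x = x.
Proof.
by move=> e; apply: slice_eqP => a; rewrite perm_sliceE; case: tpermP => // ->.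
Qed.

End Action.

(** * Permutations acting on functions, and the unnormalised inner product *)

Section Functions.
Variables (R : realType) (n m : nat).
Implicit Types (x y : slice n m) (g h : 'S_n) (u v w : slice_fun R n m).

Definition T g u : slice_fun R n m := [ffun x => u (perm_slice g x)].

Lemma TE g u x : T g u x = u (perm_slice g x). Proof. by rewrite ffunE. Qed.

Lemma T1 u : T 1%g u = u.
Proof. by apply/ffunP => x; rewrite TE perm_slice1. Qed.

Lemma TM g h u : T (g * h)%g u = T h (T g u).
Proof. by apply/ffunP => x; rewrite !TE perm_sliceM. Qed.

Lemma T_is_linear g : linear (T g).
Proof. by move=> a u v; apply/ffunP => x; rewrite !(TE, ffunE). Qed.

HB.instance Definition _ g :=
  GRing.isLinear.Build R (slice_fun R n m) (slice_fun R n m) _ (T g)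
    (T_is_linear g).

Lemma Ttt i j u : T (tperm i j) (T (tperm i j) u) = u.
Proof. by rewrite -TM tperm2 T1. Qed.

(** No division by the number of points: a nonzero integer value then contributes at least 1 to
    [dot r r], and the size of the slice enters only through the constants. *)
Definition dot u v : R := \sum_x (u x : R) * v x.

Lemma dotC u v : dot u v = dot v u.
Proof. by apply: eq_bigr => x _; rewrite mulrC. Qed.

Lemma dot_is_linear u : linear (dot u : _ -> R^o).
Proof.
move=> a v w; rewrite /dot scaler_sumr -big_split /=.
by apply: eq_bigr => x _; rewrite !ffunE /= mulrDr; congr (_ + _); apply: mulrCA.
Qed.

HB.instance Definition _ u :=
  GRing.isLinear.Build R (slice_fun R n m) R^o _ (dot u) (dot_is_linear u).

Lemma dot_T g u v : dot (T g u) (T g v) = dot u v.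
Proof.
rewrite [RHS](reindex_inj (@perm_slice_inj n m g)).
by apply: eq_bigr => x _; rewrite !TE.
Qed.

Lemma dotTt i j u v : dot (T (tperm i j) u) v = dot u (T (tperm i j) v).
Proof. by rewrite -[in RHS](dot_T (tperm i j)) Ttt. Qed.

Lemma dot_ge0 u : 0 <= dot u u.
Proof. by apply: sumr_ge0 => x _; rewrite -expr2 sqr_ge0. Qed.

Lemma dot_eq0 u : dot u u = 0 -> u = 0.
Proof.
move/eqP; rewrite psumr_eq0 => [/allP u0|x _]; last by rewrite -expr2 sqr_ge0.
apply/ffunP => x; rewrite ffunE; apply/eqP.
by have := u0 x (mem_index_enum _); rewrite mulf_eq0 orbb.
Qed.

Lemma dotDl u v w : dot (u + v) w = dot u w + dot v w.
Proof. by rewrite dotC linearD /= !(dotC w). Qed.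
Lemma dotNl u v : dot (- u) v = - dot u v.
Proof. by rewrite dotC linearN /= (dotC v). Qed.
Lemma dotZl a u v : dot (a *: u) v = a * dot u v.
Proof. by rewrite dotC linearZ /= (dotC v). Qed.
Lemma dotZr a u v : dot u (a *: v) = a * dot u v.
Proof. by rewrite linearZ. Qed.
Lemma dotBl u v w : dot (u - v) w = dot u w - dot v w.
Proof. by rewrite dotDl dotNl. Qed.

Lemma dot_diff_le u v : dot (u - v) (u - v) <= 2 * dot u u + 2 * dot v v.
Proof.
rewrite !mulr_sumr -big_split; apply: ler_sum => x _; rewrite !ffunE /=.
by have := sqr_ge0 ((u x : R) + v x); nra.
Qed.

Lemma dot_CS u v : dot u v ^+ 2 <= dot u u * dot v v.
Proof.
have [/dot_eq0 ->|v0] := eqVneq (dot v v) 0.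
  by rewrite !linear0 expr0n mulr0.
have vp : 0 < dot v v by rewrite lt_neqAle eq_sym v0 dot_ge0.
have := dot_ge0 (dot v v *: u - dot u v *: v).
rewrite !linearB /= !dotBl !dotZl !dotZr (dotC v u) => h.
rewrite -subr_ge0 -(pmulr_rge0 _ vp).
by apply: le_trans h _; rewrite le_eqVlt; apply/orP; left; apply/eqP; ring.
Qed.

End Functions.

(** * Disjoint pairs of coordinates *)

Section Pairings.
Variable n : nat.
Implicit Types (q : 'I_n * 'I_n) (s : seq ('I_n * 'I_n)).

Fixpoint free s : {set 'I_n} :=
  if s is q :: s' then free s' :\ q.1 :\ q.2 else [set: 'I_n].

Fixpoint disjoint_pairs s : bool :=
  if s is q :: s' then
    [&& q.1 \in free s', q.2 \in free s', q.1 != q.2 & disjoint_pairs s']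
  else true.

Lemma card_free s : disjoint_pairs s -> (#|free s| + (size s).*2)%N = n.
Proof.
elim: s => [|q s IH] /=; first by rewrite cardsT card_ord addn0.
case/and4P=> f1 f2 q12 /IH; have := cardsD1 q.1 (free s); rewrite f1.
have := cardsD1 q.2 (free s :\ q.1); rewrite !inE eq_sym q12 f2 /= => -> -> e.
by rewrite -[RHS]e doubleS !addnS !add1n !addSn.
Qed.

Lemma in_free_neq s q a : q \in s -> a \in free s -> a != q.1 /\ a != q.2.
Proof.
elim: s => //= q' s IH; rewrite inE => /orP[/eqP ->|qs].
  by rewrite !inE => /and3P[].
by rewrite !inE => /and3P[_ _]; apply: IH.
Qed.

Lemma notin_free s a : a \notin free s -> exists2 q, q \in s & a = q.1 \/ a = q.2.
Proof.
elim: s => [|q s IH] /=; first by rewrite inE.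
rewrite !inE !negb_and !negbK => /or3P[/eqP|/eqP|/IH[q' qs aq]].
- by exists q; rewrite ?mem_head //; right.
- by exists q; rewrite ?mem_head //; left.
- by exists q'; rewrite // inE qs orbT.
Qed.

Lemma disjoint_pairsP s q q' : disjoint_pairs s -> q \in s -> q' \in s ->
  q = q' \/ [/\ q.1 != q'.1, q.1 != q'.2, q.2 != q'.1 & q.2 != q'.2].
Proof.
elim: s => //= p s IH /and4P[f1 f2 q12 ds].
rewrite !inE => /orP[/eqP ->|qs] /orP[/eqP ->|qs']; first by left.
- by right; have [? ?] := in_free_neq qs' f1; have [? ?] := in_free_neq qs' f2.
- right; have [? ?] := in_free_neq qs f1; have [? ?] := in_free_neq qs f2.
  by split; rewrite eq_sym.
- exact: IH.
Qed.

Variable m : nat.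
Implicit Types (x y : slice n m).

Definition splits s x := all (fun q => val x q.1 != val x q.2) s.

Lemma perm_slice_notin i j x a : a != i -> a != j ->
  val (perm_slice (tperm i j) x) a = val x a.
Proof. by move=> ai aj; rewrite perm_sliceE tpermD // eq_sym. Qed.

Lemma splits_free s i j x : i \in free s -> j \in free s ->
  splits s (perm_slice (tperm i j) x) = splits s x.
Proof.
move=> fi fj; apply: eq_in_all => q qs.
have [? ?] := in_free_neq qs fi; have [? ?] := in_free_neq qs fj.
by rewrite !perm_slice_notin // eq_sym.
Qed.

Lemma splits_pair s q x : disjoint_pairs s -> q \in s ->
  splits s (perm_slice (tperm q.1 q.2) x) = splits s x.
Proof.
move=> ds qs; apply: eq_in_all => q' qs'.
have [<-|[? ? ? ?]] := disjoint_pairsP ds qs' qs.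
  by rewrite !perm_sliceE tpermL tpermR eq_sym.
by rewrite !perm_slice_notin.
Qed.

(** Both points have weight m, so a pointwise inequality between them cannot be strict anywhere. *)
Lemma slice_le_eq x y : (forall i, val x i -> val y i) -> x = y.
Proof.
move=> xy; apply: slice_eqP => i.
have le (a : 'I_n) : true ->
    (val x a <= val y a ?= iff (val x a == val y a :> nat))%N.
  by move=> _; split=> //; case: (val x a) (xy a) => // ->.
have [_] := leqif_sum le.
rewrite (eqP (valP x)) (eqP (valP y)) eqxx => /esym/forallP /(_ i) /=.
by case: (val x i); case: (val y i).
Qed.

Lemma slice_exchange x y : x != y ->
  exists i j, [/\ val x i, ~~ val y i, ~~ val x j & val y j].
Proof.
move=> xy; have ex (z t : slice n m) : z != t -> exists i, val z i && ~~ val t i.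
  move=> zt; apply/existsP; apply: contraNT zt => /existsPn h.
  apply/eqP/slice_le_eq => i zi; have := h i; by rewrite zi negbK.
have [i /andP[xi yi]] := ex _ _ xy.
by rewrite eq_sym in xy; have [j /andP[yj xj]] := ex _ _ xy; exists i, j.
Qed.

(* The points splitting every pair of [s] form a single orbit under the swaps
   of the pairs of [s] and of the coordinates outside [s]. *)
Lemma splits_connected s (P : slice n m -> Prop) : disjoint_pairs s ->
    (forall x i j, splits s x -> i \in free s -> j \in free s -> P x ->
       P (perm_slice (tperm i j) x)) ->
    (forall x q, splits s x -> q \in s -> P x ->
       P (perm_slice (tperm q.1 q.2) x)) ->
  forall x y, splits s x -> splits s y -> P x -> P y.
Proof.
move=> ds Pf Pp x y; have [k] := ubnP #|[set i | val x i != val y i]|.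
elim: k x => // k IH x; rewrite ltnS => dk sx sy Px.
(* These conditions force x and y to disagree at both i and j, and the swap repairs both, so the
   Hamming distance to y drops. *)
have step i j : val x i != val y i -> val x i != val x j -> val y i != val y j ->
    splits s (perm_slice (tperm i j) x) -> P (perm_slice (tperm i j) x) -> P y.
  move=> xyi xij yij sx' Px'; apply: IH Px' => //.
  apply: leq_trans dk; apply: proper_card; apply/properP; split.
    apply/subsetP => a; rewrite !inE perm_sliceE; case: tpermP => // ->.
    - by move: xyi xij yij; case: (val x i); case: (val x j); case: (val y i); case: (val y j).
    - by move: xyi xij yij; case: (val x i); case: (val x j); case: (val y i); case: (val y j).
  exists i; rewrite !inE // perm_sliceE tpermL.
  by move: xyi xij yij; case: (val x i); case: (val x j); case: (val y i); case: (val y j).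
(* The pairs of [s] are aligned first; once x and y agree on them, all disagreements are at free
   coordinates and [slice_exchange] supplies the swap. *)
have [/hasP[q qs xq]|/hasPn nq] := boolP (has (fun q => val x q.1 != val y q.1) s).
  apply: (step q.1 q.2) => //; first exact: (allP sx).
  - exact: (allP sy).
  - by rewrite splits_pair.
  - exact: Pp.
have [<- //|xy] := eqVneq x y.
have ffree i : val x i != val y i -> i \in free s.
  apply: contraNT => /notin_free[q qs [->|->]]; first by have := nq _ qs; rewrite /= negbK.
  have /= := nq _ qs; have /= := allP sx _ qs; have /= := allP sy _ qs.
  by case: (val x q.1); case: (val x q.2); case: (val y q.1); case: (val y q.2).
have [i [j [xi yi xj yj]]] := slice_exchange xy.
have fi : i \in free s by apply: ffree; rewrite xi (negbTE yi).
have fj : j \in free s by apply: ffree; rewrite yj (negbTE xj).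
apply: (step i j); rewrite ?xi ?yj ?(negbTE yi) ?(negbTE xj) ?splits_free //.
exact: Pf.
Qed.

Lemma sum_free s x : disjoint_pairs s -> splits s x ->
  (\sum_(i in free s) val x i + size s)%N = m.
Proof.
elim: s => [|q s IH] /=.
  by move=> _ _; rewrite addn0 -[RHS](eqP (valP x)); apply: eq_bigl => i; rewrite inE.
case/and4P=> f1 f2 q12 ds /andP[xq sx]; rewrite -[RHS](IH ds sx).
rewrite (big_setD1 q.1 f1) (big_setD1 q.2) ?inE ?f2 1?eq_sym ?q12 //=.
by move: xq; case: (val x q.1); case: (val x q.2) => // _; rewrite /= ?add0n ?add1n addnS addSn.
Qed.

Definition count_splits s := #|[set x : slice n m | splits s x]|.

Lemma count_splits_move s q q' (g : 'S_n) :
  (forall p, p \in s -> g p.1 = p.1 /\ g p.2 = p.2) ->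
  g q.1 = q'.1 -> g q.2 = q'.2 ->
  count_splits (q :: s) = count_splits (q' :: s).
Proof.
move=> gs g1 g2; rewrite /count_splits -(card_imset _ (@perm_slice_inj _ m g^-1)).
apply: eq_card => x; rewrite [RHS]inE; apply/imsetP/idP.
  case=> y; rewrite inE => sy ->.
  move: sy; rewrite /splits /= !perm_sliceE -g1 -g2 !permK; congr (_ && _).
  by apply: eq_in_all => p /gs[e1 e2]; rewrite !perm_sliceE -{2}e1 -{2}e2 !permK.
move=> sx; exists (perm_slice g x); last first.
  by rewrite -perm_sliceM mulVg perm_slice1.
rewrite inE; move: sx; rewrite /splits /= !perm_sliceE g1 g2; congr (_ && _).
by apply: eq_in_all => p /gs[e1 e2]; rewrite !perm_sliceE e1 e2.
Qed.

(** Permuting the free coordinates carries any ordered pair of distinct ones to any other; this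
    uniformity feeds the double counting below. *)
Lemma count_splits_const s i j a b :
    i \in free s -> j \in free s -> a \in free s -> b \in free s ->
    i != j -> a != b ->
  count_splits ((i, j) :: s) = count_splits ((a, b) :: s).
Proof.
have fixs c d : c \in free s -> d \in free s ->
    forall p, p \in s -> tperm c d p.1 = p.1 /\ tperm c d p.2 = p.2.
  move=> fc fd p ps; have [? ?] := in_free_neq ps fc.
  by have [? ?] := in_free_neq ps fd; rewrite !tpermD.
have sw c d : c \in free s -> d \in free s ->
    count_splits ((c, d) :: s) = count_splits ((d, c) :: s).
  move=> fc fd; apply: (count_splits_move (g := tperm c d)); rewrite ?tpermL ?tpermR //.
  exact: fixs.
have mv c d e : c \in free s -> d \in free s -> e \in free s -> c != d -> e != d ->
    count_splits ((c, d) :: s) = count_splits ((e, d) :: s).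
  move=> fc fd fe cd ed; apply: (count_splits_move (g := tperm c e)).
  - exact: fixs.
  - by rewrite tpermL.
  - by rewrite tpermD.
move=> fi fj fa fb ij ab; have [ja|ja] := eqVneq a j.
  subst a; rewrite (sw j b) //; have [<- //|ib] := eqVneq i b.
  by apply: mv; rewrite // eq_sym.
by rewrite (mv i j a) // sw // (mv j a b) ?(sw b a) // eq_sym.
Qed.

(** Double counting of the triples (x, a, b) with x splitting [s] and a, b free coordinates at which
    x differs. With l = [size s], such an x has m - l ones and n - m - l zeros among its n - 2l free
    coordinates. *)
Lemma count_splits_cons s i j : disjoint_pairs ((i, j) :: s) ->
  ((n - (size s).*2) * (n - (size s).*2).-1 * count_splits ((i, j) :: s))%N
  = (2 * (m - size s) * (n - m - size s) * count_splits s)%N.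
Proof.
case/and4P=> /= fi fj ij ds; set A := free s.
have cA : #|A| = (n - (size s).*2)%N by rewrite -[X in (X - _)%N](card_free ds) addnK.
transitivity (\sum_(a in A) \sum_(b in A) \sum_(x : slice n m | splits s x)
   (val x a != val x b))%N; last first.
  under eq_bigr do rewrite exchange_big /=.
  rewrite exchange_big /= (eq_bigr (fun _ => 2 * (m - size s) * (n - m - size s))%N).
    by rewrite sum_nat_const mulnC /count_splits; congr (_ * _)%N; apply: eq_card => x; rewrite inE.
  move=> x sx; have o1 := sum_free ds sx.
  have o0 : (\sum_(a in A) val x a + \sum_(a in A) ~~ val x a)%N = #|A|.
    by rewrite -big_split /= -sum1_card; apply: eq_bigr => a _; case: (val x a).
  have e1 : (\sum_(a in A) val x a = m - size s)%N by rewrite -[X in (X - _)%N]o1 addnK.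
  have e0 : (\sum_(a in A) ~~ val x a = n - m - size s)%N.
    have := card_free ds; move: o0 o1; rewrite -/A e1; lia.
  rewrite -e1 -e0.
  transitivity (\sum_(a in A) \sum_(b in A) (val x a * ~~ val x b + ~~ val x a * val x b))%N.
    by apply: eq_bigr => a _; apply: eq_bigr => b _; case: (val x a); case: (val x b).
  under eq_bigr do rewrite big_split /= -!big_distrr /=.
  by rewrite big_split /= -!big_distrl /=; lia.
(* The count with a, b chosen first: every ordered pair of distinct free coordinates contributes the
   same number of points. *)
transitivity (\sum_(a in A) \sum_(b in A :\ a) count_splits ((i, j) :: s))%N.
  rewrite -cA; under eq_bigr do rewrite sum_nat_const.
  rewrite (eq_bigr (fun _ => #|A|.-1 * count_splits ((i, j) :: s))%N) => [|a aA].
    by rewrite sum_nat_const mulnA.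
  by rewrite (cardsD1 a A) aA.
apply: eq_bigr => a aA; rewrite [RHS](big_setD1 a) //= [X in (X + _)%N]big1 ?add0n => [|x _]; last by rewrite eqxx.
apply: eq_bigr => b; rewrite !inE => /andP[ba bA].
rewrite (count_splits_const (a := a) (b := b)) // 1?eq_sym //.
rewrite /count_splits -sum1_card (eq_bigl (fun x => splits s x && (val x a != val x b))).
  by rewrite big_mkcondr; apply: eq_bigr => x _; case: eqP.
by move=> x; rewrite inE /splits /= andbC.
Qed.

End Pairings.

(** * Laplacians and hypercontractivity *)

Section Operators.
Variables (R : realType) (n m : nat).
Implicit Types (x y : slice n m) (u v w : slice_fun R n m).
Implicit Types (q : 'I_n * 'I_n) (s : seq ('I_n * 'I_n)) (A : {set 'I_n}).

Lemma tperm_commute (i j a b : 'I_n) :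
  i != a -> i != b -> j != a -> j != b -> commute (tperm i j) (tperm a b).
Proof.
by move=> *; rewrite /commute conjgC tpermJ !tpermD // eq_sym.
Qed.

Lemma T_commute (g h : 'S_n) u : commute g h -> T g (T h u) = T h (T g u).
Proof. by move=> gh; rewrite -!TM gh. Qed.

Definition D s u := foldr (fun q w => w - T (tperm q.1 q.2) w) u s.

Definition antisym s u := forall q, q \in s -> T (tperm q.1 q.2) u = - u.

Lemma eq_opp0 (a : R) : a = - a -> a = 0.
Proof. by move=> e; lra. Qed.

(** The transposition of a pair that x does not split fixes x, so [u x] is its own negative. *)
Lemma antisym_eq0 s u x : antisym s u -> ~~ splits s x -> u x = 0.
Proof.
move=> us /allPn[q qs]; rewrite negbK => /eqP e.
apply: eq_opp0; have /ffunP/(_ x) := us q qs.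
by rewrite TE perm_slice_tperm_id // ffunE.
Qed.

Lemma antisym_cons q s u : disjoint_pairs (q :: s) -> antisym s u ->
  antisym (q :: s) (u - T (tperm q.1 q.2) u).
Proof.
case/and4P=> /= f1 f2 q12 ds us p; rewrite inE => /orP[/eqP ->|ps].
  by rewrite linearB /= Ttt opprB.
have [? ?] := in_free_neq ps f1; have [? ?] := in_free_neq ps f2.
rewrite linearB /= T_commute; last by apply: tperm_commute; rewrite // eq_sym.
by rewrite us // linearN /= opprB opprK addrC.
Qed.

Lemma antisym_D s u : disjoint_pairs s -> antisym s (D s u).
Proof.
elim: s => [|q s IH] // dqs; apply: antisym_cons => //; apply: IH.
by case/and4P: dqs.
Qed.

(** Ordered pairs are summed, so each transposition counts twice; hence the factor 2 in the
    eigenvalues 2 d (n + 1 - d). *)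
Definition Lap A u := \sum_(a in A) \sum_(b in A) (u - T (tperm a b) u).

(* Among x_i, x_j, x_b two values agree: if x_i = x_j then u vanishes at x and
   the two terms cancel, otherwise one transposition fixes x and the other one
   moves it to a zero of u. *)
Lemma antisym_third i j b u : T (tperm i j) u = - u ->
  i != j -> b != i -> b != j -> T (tperm i b) u + T (tperm j b) u = u.
Proof.
move=> ua ij bi bj; apply/ffunP => x; rewrite [LHS]ffunE !TE.
have u0 y : val y i = val y j -> u y = 0.
  move=> e; apply: eq_opp0; have /ffunP/(_ y) := ua.
  by rewrite TE perm_slice_tperm_id // ffunE.
have [xij|xij] := eqVneq (val x i) (val x j).
  have -> : tperm j b = (tperm i j * (tperm i b * tperm i j))%g.
    by rewrite -{1}(tpermV i j) -/(tperm i b ^ tperm i j)%g tpermJ tpermL tpermD // eq_sym.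
  rewrite (u0 x) // !perm_sliceM (perm_slice_tperm_id xij).
  by have /ffunP/(_ (perm_slice (tperm i b) x)) := ua; rewrite TE ffunE => ->; rewrite subrr.
have [xib|xib] := eqVneq (val x i) (val x b).
  rewrite (perm_slice_tperm_id xib) (u0 (perm_slice _ _)) ?addr0 //.
  by rewrite !perm_sliceE tpermL tpermD // eq_sym.
have xjb : val x j = val x b.
  by move: xij xib; case: (val x i); case: (val x j); case: (val x b).
rewrite (perm_slice_tperm_id xjb) (u0 (perm_slice _ _)) ?add0r //.
by rewrite !perm_sliceE tpermL tpermD // eq_sym.
Qed.

(** The two terms at (i, j) and (j, i) give 4 u. By [antisym_third] each further b gives u, once in
    each order, hence 2 (|A| - 2) u in all. *)
Lemma Lap_step A i j u : i \in A -> j \in A -> i != j ->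
  T (tperm i j) u = - u -> Lap A u = Lap (A :\ i :\ j) u + u *+ (2 * #|A|).
Proof.
move=> iA jA ij ua; set B := A :\ i :\ j.
have jAi : j \in A :\ i by rewrite !inE eq_sym ij.
have split (F : 'I_n -> slice_fun R n m) :
    \sum_(a in A) F a = F i + F j + \sum_(a in B) F a.
  by rewrite (big_setD1 i iA) (big_setD1 j jAi) /= addrA.
have cA : #|A| = #|B|.+2 by rewrite (cardsD1 i A) iA (cardsD1 j (A :\ i)) jAi.
have third b : b \in B -> (u - T (tperm i b) u) + (u - T (tperm j b) u) = u.
  rewrite !inE => /and3P[bj bi _].
  by rewrite addrACA -opprD antisym_third // addrK.
rewrite /Lap split !split.
under [X in _ + X = _]eq_bigr do rewrite split (tpermC _ i) (tpermC _ j).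
rewrite [X in _ + X = _](eq_bigr (fun b =>
    u + \sum_(b0 in B) (u - T (tperm b b0) u))) => [|b bB]; last by rewrite third.
rewrite !tperm1 !T1 !subrr (tpermC j i) ua opprK add0r addr0.
set X := \sum_(a in B) (u - T (tperm i a) u).
set Y := \sum_(a in B) (u - T (tperm j a) u).
rewrite big_split /=.
have XY : X + Y = u *+ #|B|.
  by rewrite /X /Y -big_split /= (eq_bigr (fun=> u)) ?sumr_const // => b; apply: third.
have -> : u + u + X + (u + u + Y) = u *+ 4 + u *+ #|B|.
  by rewrite addrACA XY -!mulr2n -mulrnA.
rewrite sumr_const [RHS]addrC addrA -!mulrnDr cA; congr (_ *+ _ + _).
by move: #|B| => c; clear; lia.
Qed.

Lemma tperm_in A i j a : i \in A -> j \in A -> (tperm i j a \in A) = (a \in A).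
Proof. by move=> iA jA; case: tpermP => [->|->|]; rewrite ?iA ?jA. Qed.

Lemma Lap_T A i j u : i \in A -> j \in A ->
  T (tperm i j) (Lap A u) = Lap A (T (tperm i j) u).
Proof.
move=> iA jA; rewrite /Lap linear_sum /= [RHS](reindex_inj (@perm_inj _ (tperm i j))).
apply: eq_big => [a|a aA]; first by rewrite tperm_in.
rewrite linear_sum /= [RHS](reindex_inj (@perm_inj _ (tperm i j))).
apply: eq_big => [b|b bA]; first by rewrite tperm_in.
by rewrite linearB /= -!TM conjgC tpermJ.
Qed.

Lemma Lap_is_linear A : linear (Lap A).
Proof.
move=> c u v; rewrite /Lap scaler_sumr -big_split; apply: eq_bigr => a _ /=.
rewrite scaler_sumr -big_split; apply: eq_bigr => b _ /=.
by rewrite linearP /= scalerBr opprD addrACA.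
Qed.

HB.instance Definition _ A :=
  GRing.isLinear.Build R (slice_fun R n m) (slice_fun R n m) _ (Lap A)
    (Lap_is_linear A).

(** For a transposition t, 1 - t is self-adjoint with square 2 (1 - t). *)
Lemma dot_Lap A u v :
  \sum_(a in A) \sum_(b in A) dot (v - T (tperm a b) v) (u - T (tperm a b) u)
  = 2 * dot v (Lap A u).
Proof.
rewrite /Lap linear_sum /= mulr_sumr; apply: eq_bigr => a _.
rewrite linear_sum /= mulr_sumr; apply: eq_bigr => b _.
rewrite dotBl !linearB /= dot_T (dotTt a b) -/(dot _ _); ring.
Qed.

Lemma dot_Lap_sym A u v : dot v (Lap A u) = dot (Lap A v) u.
Proof.
have : 2 * dot v (Lap A u) = 2 * dot (Lap A v) u.
  rewrite -dot_Lap [dot (Lap A v) _]dotC -dot_Lap.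
  by apply: eq_bigr => a _; apply: eq_bigr => b _; rewrite dotC.
by move/mulfI; apply; rewrite pnatr_eq0.
Qed.

Definition sqf u : slice_fun R n m := [ffun x => (u x : R) ^+ 2].
Definition cubef u : slice_fun R n m := [ffun x => (u x : R) ^+ 3].
Definition S4 u : R := \sum_x (u x : R) ^+ 4.

Lemma dot_sqf u : dot (sqf u) (sqf u) = S4 u.
Proof. by apply: eq_bigr => x _; rewrite ffunE; ring. Qed.

Lemma S4_ge0 u : 0 <= S4 u.
Proof. by rewrite -dot_sqf dot_ge0. Qed.

(** The right side exceeds the left by (p - r)^4 / 2. *)
Lemma cube_diff_le (p r : R) :
  (p ^+ 3 - r ^+ 3) * (p - r) <= 3 / 2 * ((p - r) ^+ 2 * (p ^+ 2 + r ^+ 2)).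
Proof. by have := sqr_ge0 ((p - r) * (p - r)); lra. Qed.

(** The square of (1 - t) u is t-invariant, so it has the same product with u^2 as with the image of
    u^2 under t; the pointwise bound is symmetrised this way. *)
Lemma dot_cube_diff a b u :
  dot (cubef u - T (tperm a b) (cubef u)) (u - T (tperm a b) u)
  <= 3 * dot (sqf (u - T (tperm a b) u)) (sqf u).
Proof.
set t := tperm a b; set w := u - T t u.
have wE x : w x = (u x : R) - u (perm_slice t x) by rewrite !ffunE.
have sw : T t (sqf w) = sqf w.
  apply/ffunP => x; rewrite !(TE, ffunE) -perm_sliceM tperm2 perm_slice1.
  by rewrite -sqrrN opprB.
have e : dot (sqf w) (sqf u) = dot (sqf w) (T t (sqf u)) by rewrite -dotTt sw.
have -> : 3 * dot (sqf w) (sqf u)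
    = 3 / 2 * (dot (sqf w) (sqf u) + dot (sqf w) (T t (sqf u))).
  by rewrite -e; field.
rewrite -linearD mulr_sumr; apply: ler_sum => x _.
rewrite !(TE, ffunE) -/t /=; exact: cube_diff_le.
Qed.

(** By [splits_connected], u^2 is constant on the points splitting [s], and u vanishes elsewhere;
    both moments are then explicit. *)
Lemma hyper_base s u (c : R) : disjoint_pairs s -> antisym s u ->
  (forall a b, a \in free s -> b \in free s -> T (tperm a b) u = u) ->
  c <= (count_splits m s)%:R -> c * S4 u <= dot u u ^+ 2.
Proof.
move=> ds us ui cs; have [/ffunP u0|] := eqVneq u 0.
  have -> : S4 u = 0 by apply: big1 => x _; rewrite u0 ffunE expr0n.
  by rewrite mulr0 sqr_ge0.
have [/existsP[x0 ux0] _|/existsPn u0 /eqP[]] := boolP [exists x, u x != 0]; last first.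
  by apply/ffunP => x; rewrite ffunE; apply/eqP/negPn.
have sx0 : splits s x0 by apply: contraNT ux0 => /(antisym_eq0 us) ->.
have uE x : (u x : R) ^+ 2 = if splits s x then (u x0 : R) ^+ 2 else 0.
  case: ifPn => [sx|/(antisym_eq0 us) ->]; last by rewrite expr0n.
  apply: (splits_connected (s := s) (P := fun x => (u x : R) ^+ 2 = (u x0 : R) ^+ 2) _ _ _ sx0 sx) => //.
  - by move=> y i j sy fi fj <-; rewrite -TE ui.
  - by move=> y q sy qs <-; rewrite -TE us // ffunE sqrrN.
have cnt (t : R) : \sum_(x : slice n m) (if splits s x then t else 0)
    = t * (count_splits m s)%:R.
  by rewrite -big_mkcond sumr_const mulr_natr; congr (_ *+ _); apply: eq_card => x; rewrite !inE.
have -> : dot u u = (u x0 : R) ^+ 2 * (count_splits m s)%:R.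
  by rewrite -cnt; apply: eq_bigr => x _; rewrite -uE expr2.
have -> : S4 u = (u x0 : R) ^+ 4 * (count_splits m s)%:R.
  rewrite -cnt; apply: eq_bigr => x _; rewrite (exprM _ 2 2) uE.
  by case: ifP => _; rewrite -?exprM ?expr0n.
rewrite mulrCA exprMn -exprM /= ler_wpM2l ?(exprn_even_ge0 _ (n := 4)) //.
by rewrite expr2 ler_wpM2r.
Qed.

(** Here e is the degree left after [size s] differences, and the eigenvalue is that of degree e on
    the free coordinates. Each step of the induction on e costs a factor 9; the bound on d keeps the
    eigenvalue positive for e > 0. *)
Lemma hyper_level d (c : R) : 0 < c -> (2 * d <= n)%N ->
    (forall s, disjoint_pairs s -> size s = d -> c <= (count_splits m s)%:R) ->
  forall e s u, disjoint_pairs s -> (size s + e)%N = d -> antisym s u ->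
    Lap (free s) u = u *+ (2 * e * (#|free s|.+1 - e)) ->
  c * S4 u <= 9 ^+ e * dot u u ^+ 2.
Proof.
move=> c0 dn cd; elim=> [|e IH] s u ds se us Lu.
  rewrite expr0 mul1r; apply: (hyper_base ds us); last by apply: cd; rewrite // -se addn0.
  move: Lu; rewrite muln0 mul0n mulr0n => Lu.
  (* Eigenvalue 0 makes a sum of squared norms of differences vanish, so u is invariant under the
     free transpositions. *)
  have := dot_Lap (free s) u u; rewrite Lu linear0 mulr0 => /eqP.
  rewrite psumr_eq0 => [/allP h|a _]; last by apply: sumr_ge0 => b _; apply: dot_ge0.
  move=> a b fa fb; have := h a (mem_index_enum _); rewrite fa /=.
  rewrite psumr_eq0 => [/allP /(_ b (mem_index_enum _))|b' _]; last exact: dot_ge0.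
  by rewrite fb /= => /eqP/dot_eq0/eqP; rewrite subr_eq0 => /eqP <-.
set mu := (2 * e.+1 * (#|free s|.+1 - e.+1))%N in Lu.
have cf := card_free ds.
have fs : (2 * e.+1 <= #|free s|)%N.
  by move: cf se dn; clear; move: #|_| (size s) => N l; lia.
have mu0 : 0 < mu%:R :> R.
  by rewrite ltr0n /mu; move: fs; clear; move: #|_| => N; nia.
have [S0|Sn0] := eqVneq (S4 u) 0.
  by rewrite S0 mulr0 mulr_ge0 ?sqr_ge0 // exprn_ge0.
have Sp : 0 < S4 u by rewrite lt_neqAle eq_sym Sn0 S4_ge0.
(* By Cauchy-Schwarz and the induction hypothesis for w = (1 - t) u, the product of w^2 and u^2 is
   at most sqrt (S4 w * S4 u), which is at most [b0 * dot w w]. *)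
set b0 := Num.sqrt (9 ^+ e / c * S4 u).
have b00 : 0 <= b0 by apply: sqrtr_ge0.
have b0E : b0 ^+ 2 = 9 ^+ e / c * S4 u.
  by apply: sqr_sqrtr; rewrite mulr_ge0 ?(ltW Sp) // divr_ge0 ?(ltW c0) // exprn_ge0.
have pair a b : a \in free s -> b \in free s ->
    dot (sqf (u - T (tperm a b) u)) (sqf u)
    <= b0 * dot (u - T (tperm a b) u) (u - T (tperm a b) u).
  move=> fa fb; set w := u - _; have [ab|ab] := eqVneq a b.
    have -> : w = 0 by rewrite /w ab tperm1 T1 subrr.
    rewrite linear0 mulr0 le_eqVlt; apply/orP; left; apply/eqP.
    by apply: big1 => x _; rewrite !ffunE expr0n mul0r.
  have dabs : disjoint_pairs ((a, b) :: s) by rewrite /= fa fb ab.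
  have wa : antisym ((a, b) :: s) w by apply: (antisym_cons dabs).
  have Lw : Lap (free s) w = w *+ mu.
    by rewrite /w linearB /= -Lap_T // Lu linearMn /= mulrnBl.
  have wab : T (tperm a b) w = - w by apply: (wa (a, b)); rewrite mem_head.
  have cab : #|free s| = #|free ((a, b) :: s)|.+2.
    move: (card_free dabs) cf; rewrite -[size _]/(size s).+1; clear.
    by move: #|_| #|_| (size s) => N N' l; lia.
  (* With N free coordinates, 2 (e + 1) (N - e) - 2 N = 2 e ((N - 2) + 1 - e): the eigenvalue drops
     to that of degree e on N - 2 coordinates. *)
  have Lw' : Lap (free ((a, b) :: s)) w
      = w *+ (2 * e * (#|free ((a, b) :: s)|.+1 - e)).
    have := Lap_step fa fb ab wab; rewrite Lw => /eqP.
    rewrite -[_ :\ _ :\ _]/(free ((a, b) :: s)).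
    rewrite -subr_eq -mulrnBr => [/eqP <-|]; last first.
      by rewrite /mu; move: fs; clear; move: #|_| => N; nia.
    congr (_ *+ _); rewrite /mu; move: fs; rewrite cab; clear.
    by move: #|_| => N; nia.
  have sd : (size ((a, b) :: s) + e)%N = d by rewrite -se /= addSnnS.
  have h := IH ((a, b) :: s) w dabs sd wa Lw'.
  have dw := dot_ge0 w.
  rewrite -(@ler_pXn2r _ 2) ?nnegrE //.
  - rewrite exprMn b0E; apply: le_trans (dot_CS _ _) _; rewrite !dot_sqf.
    rewrite -(ler_pM2l c0) mulrA; apply: le_trans (ler_wpM2r (ltW Sp) h) _.
    rewrite le_eqVlt; apply/orP; left; apply/eqP; field; exact: lt0r_neq0.
  - by apply: sumr_ge0 => x _; rewrite !ffunE mulr_ge0 ?sqr_ge0.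
  - by rewrite mulr_ge0.
(* Both sides are multiplied by twice the eigenvalue and rewritten as sums over transpositions,
   where [pair] compares them termwise. *)
have main : S4 u <= 3 * b0 * dot u u.
  rewrite -(ler_pM2l (mulr_gt0 (ltr0Sn _ 1) mu0)).
  have -> : 2 * mu%:R * S4 u
      = 2 * dot (cubef u) (Lap (free s) u).
    rewrite Lu -scaler_nat dotZr mulrA; congr (_ * _).
    by apply: eq_bigr => x _; rewrite ffunE; ring.
  rewrite -dot_Lap.
  have -> : 2 * mu%:R * (3 * b0 * dot u u) = 3 * b0 * (2 * dot u (Lap (free s) u)).
    by rewrite Lu -scaler_nat dotZr; ring.
  rewrite -dot_Lap mulr_sumr; apply: ler_sum => a fa.
  rewrite mulr_sumr; apply: ler_sum => b fb.
  apply: le_trans (dot_cube_diff a b u) _.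
  by rewrite -mulrA ler_wpM2l // pair.
have du := dot_ge0 u.
(* Squaring removes the root in [b0]; one positive factor [S4 u] then cancels and 3^2 gives the new
   9. *)
have : S4 u ^+ 2 <= (3 * b0 * dot u u) ^+ 2.
  by rewrite ler_pXn2r ?nnegrE ?(ltW Sp) // mulr_ge0 // mulr_ge0.
rewrite !exprMn b0E => h.
have hc := ler_wpM2l (ltW c0) h.
rewrite -(ler_pM2r Sp); have -> : c * S4 u * S4 u = c * S4 u ^+ 2 by ring.
apply: le_trans hc _; rewrite le_eqVlt; apply/orP; left; apply/eqP.
by rewrite (exprS 9); field; exact: lt0r_neq0.
Qed.

End Operators.

(** * Functions of degree at most k *)

Section Degree.
Variables (R : realType) (n m : nat).
Implicit Types (x y : slice n m) (u v w f g : slice_fun R n m).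
Implicit Types (A B : {set 'I_n}) (U V : {vspace slice_fun R n m}).

Local Notation AND := (@AND R n m).
Local Notation L := (@L R n m).

Lemma ANDE A x : AND A x = \prod_(i in A) (val x i)%:R.
Proof. by rewrite ffunE. Qed.

Lemma AND_forallE A x : AND A x = [forall i in A, val x i]%:R.
Proof.
rewrite ANDE; case: (boolP [forall i in A, val x i]) => [/forall_inP h|].
  by rewrite big1 // => i /h ->.
rewrite negb_forall_in => /exists_inP[i iA xi].
by rewrite (bigD1 i iA) /= (negbTE xi) mul0r.
Qed.

Lemma T_AND (s : 'S_n) A : T s (AND A) = AND (s @: A).
Proof.
apply/ffunP => x; rewrite TE !ANDE big_imset => [|i j _ _]; last exact: perm_inj.
by apply: eq_bigr => i _; rewrite perm_sliceE.
Qed.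

Lemma AND_in_L A k : (#|A| <= k)%N -> AND A \in L k.
Proof. by move=> Ak; apply/memv_span/imageP; exists A. Qed.

Lemma L_subv U k : (forall A, (#|A| <= k)%N -> AND A \in U) -> (L k <= U)%VS.
Proof. by move=> h; apply/span_subvP => _ /imageP[A Ak ->]; apply: h. Qed.

Lemma L_linear U k (h : {linear slice_fun R n m -> slice_fun R n m}) :
  (forall A, (#|A| <= k)%N -> h (AND A) \in U) ->
  forall v, v \in L k -> h v \in U.
Proof.
move=> hA v vL; rewrite -[h v](lfunE h) memv_preim.
by apply: (subvP (L_subv _)) vL => A Ak; rewrite -memv_preim lfunE; apply: hA.
Qed.

Lemma L_T s k v : v \in L k -> T s v \in L k.
Proof.
move: v; apply: L_linear => A Ak /=; rewrite T_AND; apply: AND_in_L.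
by rewrite card_imset //; apply: perm_inj.
Qed.

Lemma L_mono k l : (k <= l)%N -> (L k <= L l)%VS.
Proof. by move=> kl; apply: L_subv => A Ak; apply/AND_in_L/(leq_trans Ak). Qed.

Definition ones x : {set 'I_n} := [set i | val x i].

Lemma card_ones x : #|ones x| = m.
Proof.
rewrite -[RHS](eqP (valP x)) -sum1_card big_mkcond /=.
by apply: eq_bigr => i _; rewrite inE; case: (val x i).
Qed.

(** Among points of weight m, the monomial of the ones of x is the indicator of x. *)
Lemma mem_L_top f : f \in L m.
Proof.
suff -> : f = \sum_x (f x : R) *: AND (ones x).
  by apply: memv_suml => x _; apply/memvZ/AND_in_L; rewrite card_ones.
apply/ffunP => y; rewrite sum_ffunE (bigD1 y) //= big1 => [|x xy].
  rewrite ffunE AND_forallE addr0; case: forall_inP => [_|[]].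
    by rewrite -[_ *: _]/(_ * _) mulr1.
  by move=> i; rewrite inE.
rewrite ffunE AND_forallE; case: forall_inP => [h|_]; last by rewrite scaler0.
case/eqP: xy; apply: slice_le_eq => i xi; apply: h; by rewrite inE.
Qed.

Definition mulf u v : slice_fun R n m := [ffun x => (u x : R) * v x].

Lemma mulf_is_linear u : linear (mulf u).
Proof.
move=> a v w; apply/ffunP => x; rewrite !ffunE mulrDr; congr (_ + _).
by apply: mulrCA.
Qed.

HB.instance Definition _ u :=
  GRing.isLinear.Build R (slice_fun R n m) (slice_fun R n m) _ (mulf u)
    (mulf_is_linear u).

Lemma mulfC u v : mulf u v = mulf v u.
Proof. by apply/ffunP => x; rewrite !ffunE mulrC. Qed.

Lemma mulf_AND A B : mulf (AND A) (AND B) = AND (A :|: B).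
Proof.
apply/ffunP => x; rewrite ffunE !AND_forallE -natrM mulnb; congr (_%:R).
congr nat_of_bool; apply/andP/forall_inP => [[/forall_inP a /forall_inP b] i|h].
  by rewrite inE => /orP[/a|/b].
by split; apply/forall_inP => i iA; apply: h; rewrite inE iA ?orbT.
Qed.

Lemma L_mulf k l u v : u \in L k -> v \in L l -> mulf u v \in L (k + l).
Proof.
move=> uk; move: v; apply: L_linear => B Bl /=; rewrite mulfC.
move: u uk; apply: L_linear => A Ak /=; rewrite mulfC mulf_AND; apply: AND_in_L.
by apply: leq_trans (leq_card_setU _ _) _; apply: leq_add.
Qed.

(** Up to monomials of lower degree, a monomial is an eigenfunction. Only transpositions with
    exactly one index in A move it, and summing the exchanged monomials over b outside A lowers the
    degree because all coordinates sum to m. *)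
Lemma Lap_AND A :
  Lap [set: 'I_n] (AND A) =
    AND A *+ (2 * #|A| * (n.+1 - #|A|))
    - (2 * (m%:R + 1 - #|A|%:R)) *: \sum_(a in A) AND (A :\ a).
Proof.
set d := #|A|.
pose H a b := AND A - mulf (AND [set b]) (AND (A :\ a)).
have G a b : AND A - T (tperm a b) (AND A) =
    (if (a \in A) && (b \notin A) then H a b else 0)
    + (if (b \in A) && (a \notin A) then H b a else 0).
  have swap c e : c \in A -> e \notin A ->
      AND A - T (tperm c e) (AND A) = H c e.
    move=> cA eA; rewrite /H mulf_AND T_AND; congr (_ - AND _).
    apply/setP => i; apply/imsetP/idP => [[j jA ->]|]; rewrite !inE.
      case: tpermP => [_|je|/eqP jc _]; first by rewrite eqxx.
      - by rewrite -je jA in eA.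
      - by rewrite jA jc orbT.
    case/orP => [/eqP ->|/andP[ic iA]]; first by exists c; rewrite ?tpermL.
    exists i => //; rewrite tpermD // 1?eq_sym //.
    by apply: contraNneq eA => <-.
  have [aA|aA] := boolP (a \in A); have [bA|bA] := boolP (b \in A) => /=.
  - rewrite addr0 T_AND; have -> : tperm a b @: A = A; last exact: subrr.
    apply/eqP; rewrite eqEcard card_imset ?leqnn ?andbT; last exact: perm_inj.
    by apply/subsetP => _ /imsetP[j jA ->]; rewrite tperm_in.
  - by rewrite addr0 swap.
  - by rewrite add0r tpermC swap.
  - rewrite addr0 T_AND; have -> : tperm a b @: A = A; last exact: subrr.
    apply/eqP; rewrite eqEcard card_imset ?leqnn ?andbT; last exact: perm_inj.
    apply/subsetP => _ /imsetP[j jA ->]; rewrite tpermD //.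
      by apply: contraNneq aA => ->.
    by apply: contraNneq bA => ->.
have -> : Lap [set: 'I_n] (AND A) = (\sum_(a in A) \sum_(b in ~: A) H a b) *+ 2.
  rewrite /Lap mulr2n; under eq_bigr do (under eq_bigr do rewrite G; rewrite big_split).
  rewrite big_split /=; congr (_ + _); last rewrite exchange_big /=.
    rewrite [RHS]big_mkcond /=; apply: eq_big => [a|a _]; first by rewrite inE.
    case: ifP => aA; last by apply: big1.
    by rewrite [RHS]big_mkcond /=; apply: eq_big => [b|b _]; rewrite inE.
  rewrite [RHS]big_mkcond /=; apply: eq_big => [a|a _]; first by rewrite inE.
  case: ifP => aA; last by apply: big1.
  by rewrite [RHS]big_mkcond /=; apply: eq_big => [b|b _]; rewrite inE.
have dn : (d <= n)%N by rewrite -[n in (_ <= n)%N]card_ord max_card.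
(* The sum of x_b over b outside A is m minus the sum over A; where the monomial of A minus a is 1,
   the latter is x_a + d - 1. The x_a term supplies the extra copy in n + 1 - d. *)
have row a : a \in A -> \sum_(b in ~: A) H a b =
    AND A *+ (n.+1 - d) - (m%:R + 1 - d%:R) *: AND (A :\ a).
  move=> aA; rewrite /H sumrB sumr_const.
  have cC : #|~: A| = (n - d)%N by rewrite cardsCs setCK card_ord.
  rewrite cC subSn // mulrS [AND A + _]addrC -addrA; congr (_ + _).
  apply/ffunP => x; rewrite ffunE sum_ffunE !ffunE -!ANDE.
  set t := AND (A :\ a) x.
  have tot : \sum_(b in ~: A) (val x b)%:R + \sum_(b in A) (val x b)%:R = m%:R :> R.
    rewrite -[in RHS](eqP (valP x)) natr_sum addrC [RHS](bigID (mem A)) /=.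
    by congr (_ + _); apply: eq_bigl => b; rewrite inE.
  have e1 : \sum_(b in ~: A) mulf (AND [set b]) (AND (A :\ a)) x
      = (\sum_(b in ~: A) (val x b)%:R) * t :> R.
    rewrite mulr_suml; apply: eq_bigr => b _.
    by rewrite ffunE ANDE big_set1.
  have e2 : (\sum_(b in A) (val x b)%:R) * t = AND A x + (d%:R - 1) * t :> R.
    rewrite (big_setD1 a aA) /= mulrDl; congr (_ + _).
      by rewrite /t !ANDE [RHS](big_setD1 a aA).
    have -> : d%:R - 1 = #|A :\ a|%:R :> R.
      by rewrite /d (cardsD1 a A) aA natrD addrAC subrr add0r.
    rewrite /t AND_forallE; case: forall_inP => [h|_]; last by rewrite !mulr0.
    by rewrite !mulr1 -sum1_card natr_sum; apply: eq_bigr => b /h ->.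
  rewrite e1 -[_ *: _]/(_ * _).
  have -> : \sum_(b in ~: A) (val x b)%:R = m%:R - \sum_(b in A) (val x b)%:R :> R.
    by rewrite -tot addrK.
  rewrite mulrBl e2; ring.
rewrite (eq_bigr _ row) sumrB sumr_const -scaler_sumr -/d -mulrnA mulrnBl -!mulrnA.
congr (_ *+ _ - _); first by lia.
by rewrite -scaler_nat scalerA.
Qed.

End Degree.

(** * Orthogonal projections, level parts, and hypercontractivity in bounded degree *)

Section Projection.
Variables (R : realType) (n m : nat).
Implicit Types (x y : slice n m) (u v w f g : slice_fun R n m).
Implicit Types (U V : {vspace slice_fun R n m}).

Local Notation L := (@L R n m).

Definition perp U f : Prop := forall v, v \in U -> dot v f = 0.

Lemma perpB U f g : perp U f -> perp U g -> perp U (f - g).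
Proof. by move=> pf pg v vU; rewrite linearB /= pf // pg // subr0. Qed.

Lemma perpS U V f : (U <= V)%VS -> perp V f -> perp U f.
Proof. by move=> UV pf v vU; apply: pf; apply: subvP UV v vU. Qed.

Lemma perp_span (X : seq (slice_fun R n m)) f :
  (forall v, v \in X -> dot v f = 0) -> perp <<X>> f.
Proof.
move=> h v vX; apply/eqP; rewrite dotC.
have : v \in lker (linfun (dot f : _ -> R^o)).
  apply: subvP vX; apply/span_subvP => w wX.
  by rewrite memv_ker lfunE /= dotC h.
by rewrite memv_ker lfunE.
Qed.

(** Gram-Schmidt along the generating list: the new vector is replaced by its part orthogonal to the
    earlier ones, which may be zero. *)
Lemma perp_decomp_span (X : seq (slice_fun R n m)) f :
  exists2 g, g \in <<X>>%VS & perp <<X>> (f - g).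
Proof.
elim: X f => [|x X IH] f.
  exists 0; first exact: mem0v.
  by move=> v; rewrite span_nil memv0 => /eqP ->; rewrite dotC linear0.
have sub : (<<X>> <= <<x :: X>>)%VS by rewrite span_cons addvSr.
have [x1 x1X px1] := IH x; have [g gX pg] := IH f.
set x' := x - x1 in px1 *.
have x'X : x' \in <<x :: X>>%VS.
  by rewrite rpredB ?(subvP sub _ x1X) // memv_span ?mem_head.
have [x'0|x'n0] := eqVneq (dot x' x') 0.
  exists g; first exact: (subvP sub).
  have xx1 : x = x1 by apply/eqP; rewrite -subr_eq0 -/x' (dot_eq0 x'0).
  apply: perp_span => v; rewrite inE => /orP[/eqP ->|vX]; apply: pg.
    by rewrite xx1.
  exact: memv_span.
pose t := dot x' (f - g) / dot x' x'.
exists (g + t *: x'); first by rewrite rpredD ?rpredZ // (subvP sub _ gX).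
rewrite opprD addrA.
have pX v : v \in <<X>>%VS -> dot v (f - g - t *: x') = 0.
  by move=> vX; rewrite linearB /= pg // dotZr px1 // mulr0 subr0.
apply: perp_span => v; rewrite inE => /orP[/eqP ->|vX]; last exact/pX/memv_span.
have -> : x = x' + x1 by rewrite subrK.
by rewrite dotDl (pX x1) // addr0 linearB /= dotZr divfK // subrr.
Qed.

Lemma perp_decomp U f : exists2 g, g \in U & perp U (f - g).
Proof.
by have := perp_decomp_span (vbasis U) f; rewrite (span_basis (vbasisP U)).
Qed.

Lemma perp_self U f : f \in U -> perp U f -> f = 0.
Proof. by move=> fU pf; apply/dot_eq0/pf. Qed.

Lemma dot_perp U f g : f \in U -> perp U g -> dot (f + g) (f + g) = dot f f + dot g g.
Proof.
by move=> fU pg; rewrite linearD /= !dotDl (dotC g f) (pg f fU); ring.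
Qed.

Hypothesis mn : (m <= n)%N.

Lemma slice_inhabited : exists x : slice n m, true.
Proof.
have h : (\sum_(i < n) [ffun i : 'I_n => (i < m)%N] i == m)%N.
  apply/eqP; transitivity (\sum_(i < m) 1)%N; last by rewrite sum1_card card_ord.
  rewrite (big_ord_widen n (fun=> 1%N) mn).
  by rewrite [RHS]big_mkcond; apply: eq_bigr => i _; rewrite ffunE; case: ltnP.
by exists (exist _ [ffun i : 'I_n => (i < m)%N] h).
Qed.

Lemma card_slice_gt0 : 0 < #|{: slice n m}|%:R :> R.
Proof. by have [x _] := slice_inhabited; rewrite ltr0n; apply/card_gt0P; exists x. Qed.

Lemma innerE f g : inner f g = dot f g / #|{: slice n m}|%:R.
Proof. by []. Qed.

Lemma inner_is_linear f : linear (inner f : _ -> R^o).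
Proof.
by move=> a u v; rewrite !innerE linearP /= mulrDl; congr (_ + _); apply: esym; apply: mulrA.
Qed.

HB.instance Definition _ f :=
  GRing.isLinear.Build R (slice_fun R n m) R^o _ (inner f) (inner_is_linear f).

Lemma orthvP U f : reflect (perp U f) (f \in orthv U).
Proof.
have kerE i : (f \in lker (linfun (inner (vbasis U)`_i : _ -> R^o)))
    = (dot (vbasis U)`_i f == 0).
  rewrite memv_ker lfunE /= innerE mulf_eq0 invr_eq0.
  by rewrite (gt_eqF card_slice_gt0) orbF.
rewrite /orthv memvE; apply: (iffP subv_bigcapP) => [h v vU|pf i _].
  apply: (perp_span (X := vbasis U)); last by rewrite (span_basis (vbasisP U)).
  move=> w /(nthP 0)[i]; rewrite size_tuple => iU <-; apply/eqP.
  by rewrite -kerE memvE; apply: (h (Ordinal iU)).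
by rewrite -memvE kerE pf // vbasis_mem // mem_nth // size_tuple.
Qed.

Lemma orth_projE U f g : g \in U -> perp U (f - g) -> orth_proj U f = g.
Proof.
move=> gU pfg; have UV0 : (U :&: orthv U)%VS = 0%VS.
  apply/eqP; rewrite -subv0; apply/subvP => v; rewrite memv_cap memv0 => /andP[vU].
  by move/orthvP/(perp_self vU) ->.
have h : f - g \in orthv U by apply/orthvP.
rewrite /orth_proj -{1}(subrK g f) linearD /= (daddv_pi_id UV0 gU).
suff -> : daddv_pi U (orthv U) (f - g) = 0 by rewrite add0r.
have VU0 : (orthv U :&: U)%VS = 0%VS by rewrite capvC.
have := daddv_pi_add UV0 (subvP (addvSr U _) _ h).
by rewrite (daddv_pi_id VU0 h) => /(canRL (addrK _)) ->; rewrite subrr.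
Qed.

Lemma orth_proj_perp U f : orth_proj U f \in U /\ perp U (f - orth_proj U f).
Proof.
by have [g gU pg] := perp_decomp U f; rewrite (orth_projE gU pg).
Qed.

(** The spaces are nested, so projecting to the orthogonal complement of one in the next is a
    difference of projections; this makes [above] telescope. *)
Lemma level_partE d f :
  level_part d.+1 f = orth_proj (L d.+1) f - orth_proj (L d) f.
Proof.
have [gU pg] := orth_proj_perp (L d.+1) f; have [hU ph] := orth_proj_perp (L d) f.
have sub := L_mono R n m (leqnSn d).
set g := orth_proj (L d.+1) f in gU pg *; set h := orth_proj (L d) f in hU ph *.
apply: orth_projE.
  rewrite memv_cap rpredB //=; last exact: (subvP sub).
  apply/orthvP; have -> : g - h = (f - h) - (f - g).
    by rewrite opprB [RHS]addrC addrA subrK.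
  by apply: perpB => //; apply: perpS pg.
move=> v; rewrite memv_cap => /andP[vL /orthvP pv].
by rewrite opprB addrCA addrC linearD /= pg // dotC pv // addr0.
Qed.

(** After telescoping, the top term is f itself, because L_m is the whole space and m <= n. *)
Lemma aboveP k f : f - above k f \in L k /\ perp (L k) (above k f).
Proof.
have -> : above k f = f - orth_proj (L k) f.
  have top l : (n <= l)%N -> orth_proj (L l) f = f.
    move=> nl; apply: orth_projE; last by move=> v _; rewrite subrr linear0.
    apply: (subvP (L_mono R n m (leq_trans mn nl))); exact: mem_L_top.
  rewrite /above; have [kn|nk] := leqP k n; last first.
    by rewrite big_geq ?top ?subrr // ltnW.
  rewrite big_add1 /=; under eq_bigr do rewrite level_partE.
  by rewrite telescope_sumr // top.
have [gU pg] := orth_proj_perp (L k) f; split=> //.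
by rewrite opprB addrC subrK.
Qed.

(** By [Lap_AND], the Laplacian minus the scalar c maps L_d into the previous space. Applied to v it
    is also orthogonal to that space by self-adjointness, hence zero. *)
Lemma L_eigen d v : v \in L d -> perp (L_prev R n m d) v ->
  Lap [set: 'I_n] v = v *+ (2 * d * (n.+1 - d)).
Proof.
move=> vL pv; set c := (2 * d * (n.+1 - d))%N.
pose h : {linear slice_fun R n m -> slice_fun R n m} := Lap [set: 'I_n] \- ( *:%R c%:R).
apply/eqP; rewrite -subr_eq0 -scaler_nat -[_ - _]/(h v).
have ker w : w \in L d -> h w \in L_prev R n m d.
  move: w; apply: L_linear => A Ad; rewrite /= Lap_AND.
  have [/eqP Ad'|Ad'] := boolP (#|A| == d).
    rewrite Ad' addrAC scaler_nat subrr add0r -scaleNr; apply: rpredZ.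
    apply: memv_suml => a aA; have := cardsD1 a A; rewrite aA Ad'.
    by case: d {c h vL pv Ad Ad'} => // d [->]; apply: AND_in_L.
  have {Ad Ad'} : (#|A| < d)%N by rewrite ltn_neqAle Ad'.
  case: d {vL pv} @c @h => // d c h; rewrite ltnS => Ad /=.
  have LA (B : {set 'I_n}) : (B \subset A) -> AND R m B \in L d.
    by move=> /subset_leq_card BA; apply/AND_in_L/(leq_trans BA).
  rewrite !rpredB ?rpredMn ?rpredZ ?LA //; apply: memv_suml => a _.
  by rewrite LA // subD1set.
apply/eqP; apply: (perp_self (ker _ vL)) => w wL.
have sub : (L_prev R n m d <= L d)%VS.
  by case: d {vL pv c h ker wL} => [|d]; rewrite ?sub0v // /= L_mono.
rewrite /h /= linearB /= dot_Lap_sym dotZr (pv w wL) mulr0 subr0.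
have -> : Lap [set: 'I_n] w = h w + c%:R *: w by rewrite /h /= subrK.
by rewrite dotDl dotZl !pv ?mulr0 ?addr0 // ker // (subvP sub).
Qed.

Lemma S4D u v : S4 (u + v) <= 8 * (S4 u + S4 v).
Proof.
have le (a b : R) : (a + b) ^+ 4 <= 8 * (a ^+ 4 + b ^+ 4).
  have := sqr_ge0 (a ^+ 2 - b ^+ 2); have := sqr_ge0 (a - b).
  have := sqr_ge0 ((a - b) * (a + b)); have := sqr_ge0 ((a - b) * (a - b)); nra.
by rewrite -big_split mulr_sumr; apply: ler_sum => x _; rewrite ffunE le.
Qed.

(** The top-degree part is split off orthogonally, and [S4D] costs a factor 8 per degree. *)
Lemma hyper_L (Q : R) k : 0 <= Q ->
  (forall d v, (d <= k)%N -> (d <= m)%N -> v \in L d ->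
     Lap [set: 'I_n] v = v *+ (2 * d * (n.+1 - d)) -> S4 v <= Q * dot v v ^+ 2) ->
  forall v, v \in L k -> S4 v <= 8 ^+ k * Q * dot v v ^+ 2.
Proof.
move=> Q0; elim: k => [|k IH] hQ v vL.
  rewrite mul1r; apply: (hQ 0%N) => //; apply: L_eigen => // w.
  by rewrite memv0 dotC => /eqP ->; rewrite linear0.
have {}IH w : w \in L k -> S4 w <= 8 ^+ k * Q * dot w w ^+ 2.
  by apply: IH => d w' dk; apply: hQ; apply: leqW.
have p0 : 0 <= 8 ^+ k :> R by apply: exprn_ge0.
(* Beyond m no new functions appear, so eigenfunctions of degree at most m suffice. *)
have [km|mk] := leqP k.+1 m; last first.
  apply: le_trans (IH v _) _; first by apply: (subvP (@L_mono R n m m k mk)); apply: mem_L_top.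
  rewrite ler_wpM2r ?sqr_ge0 // ler_wpM2r // exprS ler_peMl //.
  by rewrite ler1n.
have [g gL pg] := perp_decomp (L k) v.
have wL : v - g \in L k.+1.
  by rewrite rpredB // (subvP (L_mono R n m (leqnSn k)) _ gL).
have hw := hQ k.+1 _ (leqnn _) km wL (L_eigen wL pg); have hg := IH g gL.
have -> : v = g + (v - g) by rewrite addrC subrK.
set w := v - g in pg wL hw *.
rewrite (dot_perp gL pg); apply: le_trans (S4D _ _) _.
have dg := dot_ge0 g; have dw := dot_ge0 w.
have hw' : S4 w <= 8 ^+ k * Q * dot w w ^+ 2.
  apply: le_trans hw _; rewrite ler_wpM2r ?sqr_ge0 // ler_peMl //.
  by rewrite exprn_ege1 // ler1n.
rewrite exprS -!mulrA ler_wpM2l //; apply: le_trans (lerD hg hw') _.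
rewrite -mulrDr mulrA ler_wpM2l ?mulr_ge0 //.
by have := mulr_ge0 dg dw; nra.
Qed.

End Projection.

(** * Rounding to integer-valued functions of degree at most k *)

Section Rounding.
Variables (R : realType) (n m : nat).
Implicit Types (x y : slice n m) (u v w W r : slice_fun R n m) (g : 'S_n).
Implicit Types (q : 'I_n * 'I_n) (s : seq ('I_n * 'I_n)).

Local Notation L := (@L R n m).

Definition intf u : Prop := forall x, (u x : R) \is a Num.int.

Lemma intfB u v : intf u -> intf v -> intf (u - v).
Proof. by move=> iu iv x; rewrite !ffunE rpredB. Qed.

Lemma intfD u v : intf u -> intf v -> intf (u + v).
Proof. by move=> iu iv x; rewrite ffunE rpredD. Qed.

Lemma intf_T (g : 'S_n) u : intf u -> intf (T g u).
Proof. by move=> iu x; rewrite TE. Qed.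

Lemma intf_D s u : intf u -> intf (D s u).
Proof. by move=> iu; elim: s => //= q s IH; apply: intfB => //; apply: intf_T. Qed.

Lemma perp_L_T k (g : 'S_n) v : perp (L k) v -> perp (L k) (T g v).
Proof. by move=> pv w wL; rewrite -(dot_T g^-1) -TM mulgV T1 pv // L_T. Qed.

Lemma int_sqr_ge1 (a : R) : a \is a Num.int -> a != 0 -> 1 <= a ^+ 2.
Proof.
move=> ia a0; rewrite -(ger0_norm (sqr_ge0 a)) normrX exprn_ege1 //.
exact: norm_intr_ge1.
Qed.

Definition supp u : slice_fun R n m := [ffun x => (u x != 0)%:R].

Lemma dot_supp u : dot (supp u) (supp u) = #|[pred x | u x != 0]|%:R.
Proof.
rewrite -sum1_card natr_sum [RHS]big_mkcond; apply: eq_bigr => x _ /=.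
by rewrite ffunE inE; case: eqP; rewrite /= ?mulr0 ?mulr1.
Qed.

Lemma card_supp_le r : intf r -> #|[pred x | r x != 0]|%:R <= dot r r.
Proof.
move=> ir; rewrite -dot_supp; apply: ler_sum => x _; rewrite ffunE -!expr2.
have [->|r0] := eqVneq (r x) 0; first by rewrite /= !expr0n.
by rewrite expr1n int_sqr_ge1.
Qed.

Lemma dot_sqf_supp u v : dot (sqf u) (supp v) ^+ 2 <= S4 u * #|[pred x | v x != 0]|%:R.
Proof. by rewrite -dot_supp -dot_sqf dot_CS. Qed.

(* Small-set expansion: hypercontractivity makes the low-degree part of an
   integer-valued function of small norm much smaller than the function. *)
Lemma low_degree_part_small (K : R) r (a b : slice_fun R n m)
    (U : {vspace slice_fun R n m}) :
  0 <= K -> (forall v, v \in U -> S4 v <= K * dot v v ^+ 2) ->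
  intf r -> r = a + b -> a \in U -> perp U b -> 4 * K * dot r r <= 1 ->
  dot r r <= 2 * dot b b.
Proof.
move=> K0 hK ir rab aU pb Kr.
have rE : dot r r = dot a a + dot b b by rewrite rab (dot_perp aU pb).
have ar : dot a r = dot a a by rewrite rab linearD /= (pb a aU) addr0.
(* The product of a and r sees a only on the support of r, and it equals [dot a a] by
   orthogonality. *)
have h1 : dot a a ^+ 2 <= dot r r * dot (sqf a) (supp r).
  have -> : dot (sqf a) (supp r) = dot (mulf a (supp r)) (mulf a (supp r)).
    by apply: eq_bigr => x _; rewrite !ffunE; case: eqP; rewrite /= ?mulr0 ?mulr1.
  rewrite -ar; have -> : dot a r = dot r (mulf a (supp r)).
    apply: eq_bigr => x _; rewrite !ffunE.
    by case: eqP => [->|_]; rewrite /= ?mulr0 ?mul0r // mulr1 mulrC.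
  exact: dot_CS.
have h2 : dot (sqf a) (supp r) ^+ 2 <= K * dot a a ^+ 2 * dot r r.
  apply: le_trans (dot_sqf_supp a r) _.
  apply: le_trans (ler_wpM2l (S4_ge0 a) (card_supp_le ir)) _.
  by rewrite ler_wpM2r ?dot_ge0 // hK.
(* With A = [dot a a] and r2 = [dot r r], the two bounds combine to A^2 <= K r2^3, and 4 K r2 <= 1
   gives A <= r2 / 2. *)
have : dot a a <= dot r r / 2.
  have := dot_ge0 a; have := dot_ge0 r; have b0 := dot_ge0 b.
  move: (dot a a) (dot r r) (dot (sqf a) (supp r)) h1 h2 Kr.
  move=> A r2 t h1 h2 Kr r0 A0.
  have [-> |A1] := eqVneq A 0; first by rewrite divr_ge0.
  have Ap : 0 < A by rewrite lt_neqAle eq_sym A1.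
  have h3 : A ^+ 4 <= r2 ^+ 2 * (K * A ^+ 2 * r2).
    apply: le_trans (_ : (r2 * t) ^+ 2 <= _).
      rewrite (exprM A 2 2) ler_pXn2r ?nnegrE ?sqr_ge0 //.
      by apply: le_trans h1; rewrite sqr_ge0.
    by rewrite exprMn ler_wpM2l ?sqr_ge0.
  have h4 : A ^+ 2 <= K * r2 * r2 ^+ 2.
    rewrite -(ler_pM2r (exprn_gt0 2 Ap)) -exprD; apply: le_trans h3 _.
    by rewrite le_eqVlt; apply/orP; left; apply/eqP; ring.
  have h5 : A ^+ 2 <= (r2 / 2) ^+ 2.
    have h6 : K * r2 <= 4^-1 by lra.
    apply: le_trans h4 _; apply: le_trans (ler_wpM2r (sqr_ge0 r2) h6) _.
    by rewrite le_eqVlt; apply/orP; left; apply/eqP; field.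
  by rewrite -(ler_pXn2r (n := 2)) ?nnegrE // divr_ge0.
by lra.
Qed.

(** Convexity of the squared norm, from the nonnegativity of the sum of squared deviations from the
    mean. *)
Lemma dot_avg (I : finType) (A : {set I}) (F : I -> slice_fun R n m) (c : R) :
  (0 < #|A|)%N -> (forall i, i \in A -> dot (F i) (F i) <= c) ->
  dot (#|A|%:R^-1 *: \sum_(i in A) F i) (#|A|%:R^-1 *: \sum_(i in A) F i) <= c.
Proof.
move=> A0 Fc; set a := _ *: _; have Ap : 0 < #|A|%:R :> R by rewrite ltr0n.
have sF : \sum_(i in A) F i = #|A|%:R *: a.
  by rewrite scalerA divff ?scale1r // gt_eqF.
clearbody a; have e : \sum_(i in A) dot a (F i) = #|A|%:R * dot a a.
  by rewrite -linear_sum sF /= dotZr.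
have : 0 <= \sum_(i in A) dot (F i - a) (F i - a) by apply: sumr_ge0 => i _; apply: dot_ge0.
rewrite (eq_bigr (fun i => dot (F i) (F i) - 2 * dot a (F i) + dot a a)) => [|i _]; last first.
  by rewrite linearB /= !dotBl (dotC (F i) a); ring.
rewrite big_split sumrB /= sumr_const -mulr_sumr e -(mulr_natl (dot a a)).
have : \sum_(i in A) dot (F i) (F i) <= #|A|%:R * c.
  by rewrite mulr_natl -sumr_const ler_sum.
move=> h1 h2; rewrite -(ler_pM2l Ap).
by move: h1 h2; move: (\sum_(i in A) _) (dot a a) => X Y; lra.
Qed.

(** The product of x_i - x_j over the pairs of [s]: it is 1 or -1 at the points splitting [s] and 0
    elsewhere. *)
Fixpoint chi s : slice_fun R n m :=
  if s is q :: s' then mulf (AND R m [set q.1] - AND R m [set q.2]) (chi s')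
  else AND R m set0.

Lemma chi_L s : chi s \in L (size s).
Proof.
elim: s => [|q s IH] /=; first by rewrite AND_in_L ?cards0.
by rewrite -add1n L_mulf // rpredB // AND_in_L // cards1.
Qed.

Lemma chi_cons q s x :
  chi (q :: s) x = ((val x q.1)%:R - (val x q.2)%:R) * chi s x :> R.
Proof. by rewrite /= !ffunE !big_set1. Qed.

Lemma chi_sqr s x : (chi s x : R) ^+ 2 = (splits s x)%:R.
Proof.
elim: s => [|q s IH]; first by rewrite ffunE big_set0 expr1n.
rewrite chi_cons exprMn IH /=.
by case: (val x q.1); case: (val x q.2) => /=; rewrite ?subrr ?subr0 ?sub0r ?sqrrN ?expr0n ?expr1n ?mul0r ?mul1r.
Qed.

Lemma chi_perm s (g : 'S_n) x : (forall q, q \in s -> g q.1 = q.1 /\ g q.2 = q.2) ->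
  chi s (perm_slice g x) = chi s x.
Proof.
elim: s => [|q s IH] gs; first by rewrite !ffunE !big_set0.
have [e1 e2] := gs q (mem_head _ _).
rewrite !chi_cons !perm_sliceE e1 e2 IH // => p ps; apply: gs.
by rewrite inE ps orbT.
Qed.

Lemma chi_free s i j x : i \in free s -> j \in free s ->
  chi s (perm_slice (tperm i j) x) = chi s x.
Proof.
move=> fi fj; apply: chi_perm => q qs.
have [? ?] := in_free_neq qs fi; have [? ?] := in_free_neq qs fj.
by rewrite !tpermD.
Qed.

Lemma chi_antisym s : disjoint_pairs s -> antisym s (chi s).
Proof.
elim: s => [//|p s IH] dps q; have /and4P[/= f1 f2 p12 ds] := dps.
rewrite inE => /orP[/eqP ->|qs]; apply/ffunP => x; rewrite TE [RHS]ffunE !chi_cons.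
  rewrite chi_free // !perm_sliceE tpermL tpermR -mulNr opprB.
  by [].
have [n1 n2] := in_free_neq qs f1; have [n3 n4] := in_free_neq qs f2.
rewrite !perm_slice_notin // -mulrN; congr (_ * _).
by have /ffunP/(_ x) := IH ds q qs; rewrite TE ffunE.
Qed.

Variables (k : nat) (K beta : R).
Hypothesis K_ge0 : 0 <= K.
Hypothesis hyperK : forall v, v \in L k -> S4 v <= K * dot v v ^+ 2.
Hypothesis beta_ge0 : 0 <= beta.
Hypothesis K_beta : 32 * K * beta <= 1.

(** Here b is the part of w orthogonal to L_k, so the squared distance from w to L_k is at most
    c. *)
Definition near (c : R) w : Prop :=
  exists a b, [/\ w = a + b, a \in L k, perp (L k) b & dot b b <= c].

Definition rounds w W : Prop :=
  [/\ W \in L k, intf W & dot (w - W) (w - W) <= 2 * beta].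

(** Errors do not accumulate: w - W is integer-valued with the same part orthogonal to L_k as w, so
    a rough bound 8 beta improves to twice the squared distance of w from L_k. The 32 in [K_beta] is
    4 times this 8. *)
Lemma rounds_improve c w W : intf w -> near c w -> W \in L k -> intf W ->
  dot (w - W) (w - W) <= 8 * beta -> dot (w - W) (w - W) <= 2 * c.
Proof.
move=> iw [a [b [wab aL pb bc]]] WL iW wW.
apply: le_trans (_ : 2 * dot b b <= _); last by rewrite ler_pM2l.
apply: (low_degree_part_small (a := a - W) K_ge0 hyperK _ _ _ pb).
- exact: intfB.
- by rewrite wab addrAC.
- exact: rpredB.
apply: le_trans (ler_wpM2l (mulr_ge0 (ler0n _ 4) K_ge0) wW) _.
by have -> : 4 * K * (8 * beta) = 32 * K * beta by ring.
Qed.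

Lemma rounds_intro w W : intf w -> near beta w -> W \in L k -> intf W ->
  dot (w - W) (w - W) <= 8 * beta -> rounds w W.
Proof. by move=> iw nw WL iW wW; split=> //; apply: (rounds_improve iw nw). Qed.

(** The difference W - W' is integer-valued and small, and has no part orthogonal to L_k, so the
    same estimate makes it zero. *)
Lemma rounds_unique w W W' : rounds w W -> rounds w W' -> W = W'.
Proof.
move=> [WL iW wW] [WL' iW' wW']; apply/eqP; rewrite -subr_eq0; apply/eqP/dot_eq0/le_anti.
rewrite dot_ge0 andbT.
have d8 : dot (W - W') (W - W') <= 8 * beta.
  have -> : W - W' = (w - W') - (w - W) by rewrite opprB [RHS]addrC addrA subrK.
  apply: le_trans (dot_diff_le _ _) _; lra.
have -> : 0 = 2 * dot (0 : slice_fun R n m) 0 :> R by rewrite linear0 mulr0.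
apply: (low_degree_part_small (a := W - W') (b := 0) K_ge0 hyperK).
- exact: intfB.
- by rewrite addr0.
- exact: rpredB.
- by move=> v _; rewrite linear0.
apply: le_trans (ler_wpM2l (mulr_ge0 (ler0n _ 4) K_ge0) d8) _.
by have -> : 4 * K * (8 * beta) = 32 * K * beta by ring.
Qed.

Lemma rounds_T (g : 'S_n) w W : rounds w W -> rounds (T g w) (T g W).
Proof.
by move=> [WL iW wW]; split; [apply: L_T|apply: intf_T|rewrite -linearB dot_T].
Qed.

Lemma rounds_N w W : rounds w W -> rounds (- w) (- W).
Proof.
move=> [WL iW wW]; split; first by rewrite rpredN.
- by move=> x; rewrite ffunE rpredN.
- by rewrite -opprD linearN /= dotNl opprK.
Qed.

Lemma near_le c c' w : c <= c' -> near c w -> near c' w.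
Proof. by move=> cc [a [b [? ? ? bc]]]; exists a, b; split=> //; apply: le_trans cc. Qed.

Lemma near_diff c (g : 'S_n) w : near c w -> near (4 * c) (w - T g w).
Proof.
move=> [a [b [-> aL pb bc]]]; exists (a - T g a), (b - T g b); split.
- by rewrite linearD /= opprD addrACA.
- by rewrite rpredB // L_T.
- by apply: perpB => //; apply: perp_L_T.
- by apply: le_trans (dot_diff_le _ _) _; rewrite dot_T; lra.
Qed.

(** * From approximations of the differences of u to one of u *)

Section Step.
Variables (s : seq ('I_n * 'I_n)) (u : slice_fun R n m).
Hypothesis ds : disjoint_pairs s.
Hypothesis sk : (size s <= k)%N.
Hypothesis iu : intf u.
Hypothesis us : antisym s u.
Hypothesis nu : near (beta / 4) u.
Hypothesis roundT : forall i j, i \in free s -> j \in free s ->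
  exists W, rounds (u - T (tperm i j) u) W.

Let gens : {set 'S_n} := [set tperm i j | i in free s, j in free s].
Let G : {group 'S_n} := <<gens>>%G.

Let tperm_G i j : i \in free s -> j \in free s -> tperm i j \in G.
Proof. by move=> fi fj; apply/mem_gen/imset2P; exists i j. Qed.

(** A difference at most quadruples the squared distance to L_k; hence the beta / 4 assumed for
    u. *)
Let near_G (g : 'S_n) : near beta (u - T g u).
Proof. by apply: near_le (near_diff g nu); lra. Qed.

Let int_G (g : 'S_n) : intf (u - T g u).
Proof. by apply: intfB => //; apply: intf_T. Qed.

(** Induction on word length through u - T (h t) u = (u - T t u) + T t (u - T h u); the error is
    brought back to 2 beta after each letter. *)
Lemma rounds_gen (g : 'S_n) : g \in G -> exists W, rounds (u - T g u) W.
Proof.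
case/gen_prodgP=> N [c cg ->]; elim: N c cg => [|N IH] c cg.
  exists 0; rewrite big_ord0 T1 subrr; split; first exact: mem0v.
    by move=> x; rewrite ffunE.
  by rewrite subr0 linear0 mulr_ge0.
have [W1 r1] := IH (c \o widen_ord (leqnSn N)) (fun i => cg _).
rewrite big_ord_recr /=; set h := (\prod_(i < N) _)%g in r1 *.
have /imset2P[i j fi fj ->] := cg ord_max; set t := tperm i j.
have [W2 r2] := roundT fi fj; have [W1L iW1 h1] := rounds_T t r1.
have [W2L iW2 h2] := r2.
exists (W2 + T t W1); apply: rounds_intro => //.
- exact: rpredD.
- exact: intfD.
have -> : u - T (h * t)%g u - (W2 + T t W1)
    = (u - T t u - W2) - (T t W1 - T t (u - T h u)).
  rewrite TM linearB /=.
  apply/ffunP => x; rewrite !ffunE; ring.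
have -> : 8 * beta = 2 * (2 * beta) + 2 * (2 * beta) by ring.
apply: le_trans (dot_diff_le _ _) _; apply: lerD; rewrite ler_pM2l //.
by rewrite -opprB linearN /= dotNl opprK.
Qed.

Let G_commute (g : 'S_n) q : g \in G -> q \in s -> commute g (tperm q.1 q.2).
Proof.
move=> gG qs; suff /subsetP/(_ g gG)/cent1P : (G \subset 'C[tperm q.1 q.2])%g by [].
rewrite gen_subG; apply/subsetP => _ /imset2P[i j fi fj ->]; apply/cent1P.
have [? ?] := in_free_neq qs fi; have [? ?] := in_free_neq qs fj.
exact: tperm_commute.
Qed.

Lemma rounds_step : exists W, rounds u W.
Proof.
have b4 : beta / 4 <= beta by rewrite ler_piMr ?invf_le1 ?ler1n.
have [x1 sx1|nosplit] := pickP (splits s (m := m)); last first.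
  exists 0; have -> : u = 0.
    by apply/ffunP => x; rewrite (antisym_eq0 us) ?nosplit ?ffunE.
  split; [exact: mem0v|by move=> x; rewrite ffunE|].
  by rewrite subr0 linear0 mulr_ge0.
have [h hP] : exists h : 'S_n -> slice_fun R n m,
    forall g, g \in G -> rounds (u - T g u) (h g).
  apply: (fin_all_exists (P := fun g W => g \in G -> rounds (u - T g u) W)) => g.
  have [gG|//] := boolP (g \in G); last by exists 0.
  by have [W rW] := rounds_gen gG; exists W.
(* The cocycle identity: both sides, after moving [h t], round the same function, so they agree by
   uniqueness. *)
have hM (g t : 'S_n) : g \in G -> t \in G -> T t (h g) = h (g * t)%g - h t.
  move=> gG tG; apply/eqP; rewrite eq_sym subr_eq addrC; apply/eqP.
  apply: (@rounds_unique (u - T (g * t)%g u)); first by apply: hP; rewrite groupM.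
  have [a1 b1 c1] := hP t tG; have [a2 b2 c2] := rounds_T t (hP g gG).
  apply: rounds_intro => //; [exact: rpredD|exact: intfD|].
  have -> : u - T (g * t)%g u - (h t + T t (h g))
      = (u - T t u - h t) - (T t (h g) - T t (u - T g u)).
    by rewrite TM linearB /=; apply/ffunP => x; rewrite !ffunE; ring.
  have -> : 8 * beta = 2 * (2 * beta) + 2 * (2 * beta) by ring.
  apply: le_trans (dot_diff_le _ _) _; apply: lerD; rewrite ler_pM2l //.
  by rewrite -opprB linearN /= dotNl opprK.
have hs (g : 'S_n) : g \in G -> antisym s (h g).
  move=> gG q qs; apply/eqP; rewrite -eqr_oppLR; apply/eqP.
  apply: (@rounds_unique (u - T g u)); last exact: hP.
  have := rounds_N (rounds_T (tperm q.1 q.2) (hP g gG)).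
  by rewrite linearB /= -(T_commute _ (G_commute gG qs)) us // linearN /= -opprD opprK.
have G0 : (0 < #|G|)%N by apply: cardG_gt0.
have Gn : #|G|%:R != 0 :> R by rewrite pnatr_eq0 -lt0n.
pose F := #|G|%:R^-1 *: \sum_(g in G) h g.
pose c := #|G|%:R^-1 *: \sum_(g in G) T g u.
have FL : F \in L k.
  by apply/rpredZ/memv_suml => g gG; have [] := hP g gG.
(* Averaging the cocycle identity over G exhibits h as the coboundary of F. *)
have FT (t : 'S_n) : t \in G -> T t F = F - h t.
  move=> tG; rewrite /F linearZ /= linear_sum /= (eq_bigr _ (fun g gG => hM g t gG tG)).
  rewrite sumrB sumr_const scalerBr -(scaler_nat #|G|) scalerA mulVf // scale1r.
  congr (_ *: _ - _); rewrite [RHS](reindex_inj (mulIg t)) /=.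
  by apply: eq_bigl => g; rewrite groupMr.
have cT (t : 'S_n) : t \in G -> T t c = c.
  move=> tG; rewrite /c linearZ /= linear_sum /=; congr (_ *: _).
  rewrite [RHS](reindex_inj (mulIg t)) /=.
  by apply: eq_big => [g|g _]; rewrite ?groupMr // TM.
have Fs : antisym s F.
  move=> q qs; rewrite /F linearZ /= linear_sum /= -scalerN -sumrN; congr (_ *: _).
  by apply: eq_bigr => g gG; rewrite hs.
have cs : antisym s c.
  move=> q qs; rewrite /c linearZ /= linear_sum /= -scalerN -sumrN; congr (_ *: _).
  by apply: eq_bigr => g gG; rewrite -(T_commute _ (G_commute gG qs)) us // linearN.
have close : dot (u - (F + c)) (u - (F + c)) <= 2 * beta.
  have -> : u - (F + c) = #|G|%:R^-1 *: \sum_(g in G) (u - T g u - h g).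
    rewrite !sumrB sumr_const -(scaler_nat #|G|) !scalerBr scalerA mulVf // scale1r.
    by rewrite opprD addrA addrAC.
  by apply: dot_avg => // g gG; have [] := hP g gG.
clearbody F c.
have chi_sq x : splits s x -> (chi s x : R) * chi s x = 1.
  by move=> sx; rewrite -expr2 chi_sqr sx.
(* The base point minimises the discrepancy, so that correcting W there costs no more than the
   discrepancy at any other splitting point. *)
have [x0 sx0 minx0] : exists2 x0, splits s x0 & forall x, splits s x ->
    (u x0 - (F + c) x0 : R) ^+ 2 <= (u x - (F + c) x : R) ^+ 2.
  case: (@Order.TotalTheory.arg_minP _ _ _ x1 (splits s (m := m))
     (fun x => (u x - (F + c) x : R) ^+ 2) sx1) => x0 sx0 mx; by exists x0.
pose gam : R := c x0 * chi s x0.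
(* Both sides are G-invariant and odd under the pairs of [s], so agreement at x0 spreads over the
   single orbit of splitting points. *)
have cE : c = gam *: chi s.
  apply/ffunP => x; have [sx|sx] := boolP (splits s x); last first.
    by rewrite (antisym_eq0 cs) // ffunE (antisym_eq0 (chi_antisym ds)) // scaler0.
  apply: (splits_connected (P := fun x => c x = (gam *: chi s) x) ds _ _ sx0 sx).
  - move=> y i j sy fi fj; rewrite -TE cT ?tperm_G // => ->.
    by rewrite !ffunE chi_free.
  - move=> y q sy qs e; rewrite -!TE cs // linearZ /= chi_antisym // scalerN.
    by rewrite ![fun_of_fin (- _) y]ffunE e.
  - by rewrite ffunE -[_ *: _]/(_ * _) /gam -mulrA chi_sq // mulr1.
(* This shift makes W equal to the integer u at x0. *)
pose th : R := (u x0 - (F + c) x0) * chi s x0.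
pose W := F + (gam + th) *: chi s.
have WE x : W x = (F + c) x + th * chi s x :> R.
  rewrite /W scalerDl addrA -cE [LHS]ffunE; congr (_ + _); exact: ffunE.
have Ws : antisym s W.
  by move=> q qs; rewrite linearD /= Fs // linearZ /= chi_antisym // scalerN opprD.
have Wx0 : W x0 = u x0.
  by rewrite WE /th -mulrA chi_sq // mulr1 addrC subrK.
exists W; apply: rounds_intro => //.
- exact: near_le b4 nu.
- rewrite rpredD // rpredZ //; apply: (subvP (L_mono R n m sk)); exact: chi_L.
(* Integrality spreads from x0: a free swap changes W by an integer-valued h, and a swap of a pair
   changes its sign. *)
- move=> x; have [sx|sx] := boolP (splits s x); last first.
    by rewrite (antisym_eq0 Ws).
  apply: (splits_connected (P := fun x => (W x : R) \is a Num.int) ds _ _ sx0 sx).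
  + move=> y i j sy fi fj Wy; rewrite -TE /W linearD linearZ /= FT ?tperm_G //.
    have -> : T (tperm i j) (chi s) = chi s.
      by apply/ffunP => z; rewrite TE chi_free.
    rewrite addrAC -/W ffunE rpredD // ffunE rpredN.
    by have [_ ih _] := hP _ (tperm_G fi fj).
  + by move=> y q sy qs Wy; rewrite -TE Ws // ffunE rpredN.
  + by rewrite Wx0.
(* By minimality at x0, the shift at most doubles the discrepancy pointwise, so the bound 2 beta
   becomes 8 beta. *)
apply: le_trans (_ : 4 * dot (u - (F + c)) (u - (F + c)) <= _); last first.
  apply: le_trans (ler_wpM2l (ler0n _ 4) close) _.
  by have -> : 4 * (2 * beta) = 8 * beta by ring.
rewrite mulr_sumr; apply: ler_sum => x _.
have [sx|sx] := boolP (splits s x); last first.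
  have F0 : (F + c) x = 0 by rewrite ffunE (antisym_eq0 Fs) // (antisym_eq0 cs) // addr0.
  rewrite ![fun_of_fin (u - _) x]ffunE (antisym_eq0 us) // ![fun_of_fin (- _) x]ffunE F0 (antisym_eq0 Ws) //.
  by rewrite subr0 mulr0 mulr0.
have mx := minx0 x sx; have c2 := chi_sq x sx; have c02 := chi_sq x0 sx0.
rewrite ![fun_of_fin (u - _) x]ffunE ![fun_of_fin (- _) x]ffunE WE.
have th2 : th ^+ 2 <= (u x - (F + c) x : R) ^+ 2.
  by rewrite /th exprMn [X in _ * X]expr2 c02 mulr1.
have le4 (U Y C : R) : th ^+ 2 <= (U - Y) ^+ 2 -> C * C = 1 ->
    (U - (Y + th * C)) * (U - (Y + th * C)) <= 4 * ((U - Y) * (U - Y)).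
  move=> h1 h2; have : (th * C) ^+ 2 = th ^+ 2 by rewrite exprMn expr2 -expr2 [C ^+ 2]expr2 h2 mulr1.
  move: (th * C) => z hz; have := sqr_ge0 (U - Y + z); nra.
exact: le4.
Qed.

End Step.

End Rounding.

(** * Iterated differences, the downward induction, and Boolean values *)

Section Derivatives.
Variables (R : realType) (n m : nat).
Implicit Types (u v w f : slice_fun R n m).
Implicit Types (q : 'I_n * 'I_n) (s : seq ('I_n * 'I_n)).

Local Notation L := (@L R n m).

Lemma D_is_linear s : linear (@D R n m s).
Proof.
move=> c u v; elim: s => //= q s ->.
by rewrite linearP /= scalerBr opprD addrACA.
Qed.

HB.instance Definition _ s :=
  GRing.isLinear.Build R (slice_fun R n m) (slice_fun R n m) _ (@D R n m s)
    (D_is_linear s).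

Lemma D_commute s q u : disjoint_pairs s -> q.1 \in free s -> q.2 \in free s ->
  T (tperm q.1 q.2) (D s u) = D s (T (tperm q.1 q.2) u).
Proof.
move=> + q1 q2; elim: s q1 q2 => //= p s IH.
rewrite !inE => /and3P[a1 a2 a3] /and3P[b1 b2 b3] /and4P[f1 f2 p12 ds].
rewrite linearB /= IH // T_commute ?IH //.
by apply: tperm_commute.
Qed.

Lemma disjoint_pairs_hit s (A : {set 'I_n}) : disjoint_pairs s ->
  (forall q, q \in s -> (q.1 \in A) || (q.2 \in A)) -> (size s <= #|A|)%N.
Proof.
elim: s A => //= q s IH A /and4P[f1 f2 q12 ds] hit.
have sub : A :\ q.1 :\ q.2 \proper A.
  apply/properP; split; first by apply/subsetP => i; rewrite !inE => /and3P[].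
  by have /orP[h|h] := hit q (mem_head _ _); [exists q.1|exists q.2];
    rewrite ?h // !inE eqxx ?andbF.
apply: leq_ltn_trans (proper_card sub); apply: IH => // p ps.
have [n1 n2] := in_free_neq ps f1; have [n3 n4] := in_free_neq ps f2.
by rewrite !inE ![p.1 == _]eq_sym ![p.2 == _]eq_sym n1 n2 n3 n4 hit // inE ps orbT.
Qed.

Lemma D_AND0 s q (A : {set 'I_n}) : disjoint_pairs s -> q \in s -> q.1 \notin A -> q.2 \notin A ->
  D s (AND R m A) = 0.
Proof.
move=> ds qs q1 q2; elim: s ds qs => //= p s IH /and4P[f1 f2 p12 ds].
rewrite inE => /orP[/eqP e|qs]; last by rewrite IH // linear0 subrr.
subst p; rewrite /= D_commute // T_AND; have -> : tperm q.1 q.2 @: A = A; last exact: subrr.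
rewrite -[RHS](imset_id A); apply: eq_in_imset => i iA.
by rewrite tpermD //; [apply: contraNneq q1 => ->|apply: contraNneq q2 => ->].
Qed.

(** A set of at most k coordinates misses one of more than k disjoint pairs, and the difference
    along that pair kills its monomial. *)
Lemma D_L0 s k v : disjoint_pairs s -> (k < size s)%N -> v \in L k -> D s v = 0.
Proof.
move=> ds ks vL; apply/eqP; rewrite -memv0; move: v vL; apply: L_linear => A Ak /=.
rewrite memv0; have [/hasP[q qs /norP[q1 q2]]|/hasPn h] :=
  boolP (has (fun q => ~~ ((q.1 \in A) || (q.2 \in A))) s).
  by rewrite (D_AND0 ds qs q1 q2).
have : (size s <= #|A|)%N.
  by apply: disjoint_pairs_hit => // q /h; rewrite negbK.
by rewrite leqNgt (leq_ltn_trans Ak ks).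
Qed.

Lemma perp_L_D k s v : perp (L k) v -> perp (L k) (D s v).
Proof. by move=> pv; elim: s => //= q s IH; apply: perpB => //; apply: perp_L_T. Qed.

Lemma L_D k s v : v \in L k -> D s v \in L k.
Proof. by move=> vL; elim: s => //= q s IH; rewrite rpredB // L_T. Qed.

Lemma dot_D s v : dot (D s v) (D s v) <= 4 ^+ size s * dot v v.
Proof.
elim: s => [|q s IH] /=; first by rewrite mul1r.
apply: le_trans (dot_diff_le _ _) _; rewrite dot_T exprS -mulrA.
by move: IH; move: (dot (D s v) _) (_ * dot v v) => x y; lra.
Qed.

Section Rounding.
Variables (k : nat) (K E : R).
Hypothesis K_ge0 : 0 <= K.
Hypothesis hyperK : forall v, v \in L k -> S4 v <= K * dot v v ^+ 2.

Lemma integral_near_L f : intf f -> near k E f -> 32 * K * (4 ^+ k.+2 * E) <= 1 ->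
  exists W, [/\ W \in L k, intf W & dot (f - W) (f - W) <= 2 * E].
Proof.
move=> iF nf hE; have [a [b [fab aL pb bE]]] := nf.
have E0 : 0 <= E by apply: le_trans bE; apply: dot_ge0.
(* At most k + 1 differences multiply the squared distance by at most 4^(k+1); the remaining 4
   provides the beta / 4 required by [rounds_step]. *)
set beta := 4 ^+ k.+2 * E in hE.
have beta0 : 0 <= beta by rewrite mulr_ge0 // exprn_ge0.
have all j s : disjoint_pairs s -> (size s + j)%N = k.+1 ->
    exists W, rounds k beta (D s f) W.
  elim: j s => [|j IH] s ds sj.
    exists 0; split; first exact: mem0v.
      by move=> x; rewrite ffunE.
    rewrite subr0 fab linearD /= (D_L0 ds _ aL) ?add0r; last by rewrite -sj addn0.
    apply: le_trans (dot_D s b) _; rewrite -[size s]addn0 sj.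
    apply: le_trans (ler_wpM2l _ bE) _; first exact: exprn_ge0.
    rewrite /beta [4 ^+ k.+2]exprS; set z := 4 ^+ _.
    have : 0 <= z * E by rewrite mulr_ge0 // exprn_ge0.
    by rewrite -(mulrA 4); move: (z * E) => y; lra.
  apply: (rounds_step K_ge0 hyperK beta0 hE ds) => //.
  - by move: sj; rewrite addnS => -[<-]; apply: leq_addr.
  - exact: intf_D.
  - exact: antisym_D.
  - exists (D s a), (D s b); split.
    + by rewrite fab linearD.
    + exact: L_D.
    + exact: perp_L_D.
    apply: le_trans (dot_D s b) _; apply: le_trans (_ : 4 ^+ k.+1 * E <= _).
      apply: ler_pM => //; [exact: exprn_ge0|exact: dot_ge0|].
      by rewrite ler_eXn2l ?ltr1n // -sj leq_addr.
    by rewrite le_eqVlt; apply/orP; left; apply/eqP; rewrite /beta (exprS 4 k.+1); field.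
  - move=> i l fi fl; have [->|il] := eqVneq i l.
      exists 0; rewrite tperm1 T1 subrr; split; first exact: mem0v.
        by move=> x; rewrite ffunE.
      by rewrite subr0 linear0 mulr_ge0.
    apply: (IH ((i, l) :: s)); first by rewrite /= fi fl il.
    by rewrite -sj /= addSnnS.
have [W [WL iW hW]] := all k.+1 [::] isT erefl.
(* For f itself the bound 2 beta improves to 2 E, free of the factor 4^(k+2). *)
exists W; split=> //; apply: (rounds_improve K_ge0 hyperK (beta := beta) hE iF nf WL iW).
apply: le_trans hW _; rewrite ler_wpM2r // ler_nat //.
Qed.

(** The function W^2 - W has degree at most 2 k and vanishes wherever W agrees with the Boolean g;
    hypercontractivity forbids so small a support unless it is zero. *)
Lemma boolean_of_close (g : slice n m -> bool) (K2 : R) W :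
  (forall v, v \in L (k + k) -> S4 v <= K2 * dot v v ^+ 2) ->
  W \in L k -> intf W ->
  dot (real_of_bool_fun R g - W) (real_of_bool_fun R g - W) <= E ->
  K2 * E < 1 -> 0 <= K2 -> forall x, W x = (W x == 1)%:R.
Proof.
move=> hK2 WL iW gW KE K20.
pose v := mulf W W - W.
have vL : v \in L (k + k).
  by rewrite rpredB ?L_mulf // (subvP (L_mono R n m (leq_addr k k))).
have v0 : dot v v = 0.
  apply/eqP; apply: contraTT KE => vn0; rewrite -leNgt.
  have vp : 0 < dot v v by rewrite lt_neqAle eq_sym vn0 dot_ge0.
  have cE : #|[pred x | v x != 0]|%:R <= E.
    apply: le_trans gW; have ig : intf (real_of_bool_fun R g - W).
      by apply: intfB => // x; rewrite ffunE rpred_nat.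
    apply: le_trans (card_supp_le ig); rewrite ler_nat; apply/subset_leq_card/subsetP => x.
    rewrite !inE; apply: contraNneq => /eqP; rewrite !ffunE subr_eq0 => /eqP <-.
    by case: (g x); rewrite ?mulr1 ?mulr0 subrr.
  have h1 : dot v v ^+ 2 <= S4 v * #|[pred x | v x != 0]|%:R.
    apply: le_trans (dot_sqf_supp v v); rewrite le_eqVlt; apply/orP; left; apply/eqP.
    congr (_ ^+ 2); apply: eq_bigr => x _; rewrite ![fun_of_fin (sqf _) _]ffunE [fun_of_fin (supp _) _]ffunE.
    by case: eqP => [->|_]; rewrite /= ?mulr0 ?mulr1 ?expr2.
  have h2 : dot v v ^+ 2 <= K2 * dot v v ^+ 2 * E.
    apply: le_trans h1 _; apply: ler_pM => //; [exact: S4_ge0|exact: hK2].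
  rewrite -(ler_pM2r (exprn_gt0 2 vp)) mul1r; apply: le_trans h2 _.
  by rewrite mulrAC.
move=> x; have /ffunP/(_ x) := dot_eq0 v0; rewrite !ffunE => /eqP.
rewrite subr_eq0 -[X in _ == X]mulr1 -subr_eq0 -mulrBr mulf_eq0 subr_eq0.
by case/orP => /eqP ->; rewrite ?eqxx // eq_sym oner_eq0.
Qed.

End Rounding.
End Derivatives.

(** * Lower bounds for the number of points splitting given pairs *)

(** The ratio of m^d to the falling factorial is largest at m = d, where d^d <= (2d)_d = C(2d, d) d!
    <= 4^d d!. *)
Lemma expn_le_ffact m d : (d <= m)%N -> (m ^ d <= 4 ^ d * m ^_ d)%N.
Proof.
move=> dm.
have h1 t : (t <= d)%N -> (m ^ t * d ^_ t <= m ^_ t * d ^ t)%N.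
  elim: t => // t IH td; rewrite !expnS !ffactnSr.
  have := IH (ltnW td); have : (m * (d - t) <= (m - t) * d)%N.
    by rewrite mulnBr mulnBl leq_sub2l // mulnC leq_mul2r dm orbT.
  move=> a b; have := leq_mul a b; apply: etrans; congr (_ <= _)%N; ring.
have h2 t : (t <= d)%N -> (d ^ t <= (d + d) ^_ t)%N.
  elim: t => // t IH td; rewrite expnS ffactnSr mulnC; apply: leq_mul.
    exact/IH/ltnW.
  by rewrite -addnBA ?leq_addr // ltnW.
have h3 : ('C(d + d, d) <= 4 ^ d)%N.
  have -> : (4 ^ d = (1 + 1) ^ (d + d))%N by rewrite (addnn d) -mul2n expnM.
  rewrite expnDn; have dd : (d < (d + d).+1)%N by rewrite ltnS leq_addr.
  by rewrite (bigD1 (Ordinal dd)) //= !exp1n !muln1 leq_addr.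
have d0 : (0 < d`!)%N by apply: fact_gt0.
rewrite -(leq_pmul2r d0); have := h1 d (leqnn d); rewrite ffactnn => h.
apply: leq_trans h _; rewrite [(4 ^ d * _)%N]mulnC -mulnA leq_mul2l.
apply/orP; right; apply: leq_trans (h2 d (leqnn d)) _.
by rewrite -bin_ffact leq_mul2r h3 orbT.
Qed.

(** By [count_splits_cons], one more pair keeps at least a fraction (m - l) / n of the points, as 2m
    <= n gives n - 2l <= 2 (n - m - l). *)
Lemma count_splits_ge n m (s : seq ('I_n * 'I_n)) :
  (2 * m <= n)%N -> disjoint_pairs s -> (size s <= m)%N ->
  (#|{: slice n m}| * m ^_ size s <= count_splits m s * n ^ size s)%N.
Proof.
move=> mn; elim: s => [|[i j] s IH] dijs sm.
  by rewrite /= !muln1 /count_splits; apply: subset_leq_card; apply/subsetP => x; rewrite inE.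
have /and4P[_ _ _ ds] := dijs.
have {}IH := IH ds (ltnW sm); rewrite [size _]/= in sm *.
have := count_splits_cons m dijs.
move: IH; rewrite ffactnSr expnS; move: (count_splits m _) (count_splits m s) (#|{: slice n m}|).
move=> c' c N; move: (m ^_ size s)%N (n ^ size s)%N => a b.
move: sm mn; clear; move: (size s) => l sm mn h.
have [N1 nN] : (0 < n - l.*2 /\ n - l.*2 <= 2 * (n - m - l))%N by split; lia.
rewrite -mulnA -(mulnA _ (n - m - l)%N) => e.
have e1 : ((m - l) * c <= (n - l.*2).-1 * c')%N.
  rewrite -(leq_pmul2l N1) mulnA [X in (_ <= X)%N]mulnA -[X in (_ <= X)%N]mulnA.
  rewrite [X in (_ <= X)%N]e.
  apply: leq_trans (_ : 2 * (n - m - l) * ((m - l) * c) <= _)%N.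
    by rewrite -mulnA leq_mul2r nN orbT.
  by rewrite leq_eqVlt; apply/orP; left; apply/eqP; ring.
have e2 : ((m - l) * c <= n * c')%N.
  by apply: leq_trans e1 _; rewrite leq_mul2r; apply/orP; right; lia.
rewrite mulnA; apply: leq_trans (leq_mul h (leqnn _)) _.
rewrite mulnAC [X in (X * _ <= _)%N]mulnC; apply: leq_trans (leq_mul e2 (leqnn b)) _.
by rewrite leq_eqVlt; apply/orP; left; apply/eqP; ring.
Qed.

(** * Constants *)

Section SliceConstants.
Variables (R : realType) (p : R) (n m : nat).
Hypotheses (p_gt0 : 0 < p) (p_le : p <= 1 / 2) (n_gt0 : (0 < n)%N).
Hypothesis pn : p * n%:R = m%:R.

Lemma double_weight_le : (2 * m <= n)%N.
Proof.
rewrite -(ler_nat R) natrM -pn mulrA -[leRHS]mul1r ler_wpM2r //.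
by have := p_le; lra.
Qed.

Lemma count_splits_lower (s : seq ('I_n * 'I_n)) : disjoint_pairs s ->
  (size s <= m)%N ->
  #|{: slice n m}|%:R * (p / 4) ^+ size s <= (count_splits m s)%:R :> R.
Proof.
move=> ds sm; set d := size s; set N := #|{: slice n m}|; set c := count_splits m s.
have nd : 0 < n%:R ^+ d :> R by rewrite exprn_gt0 // ltr0n.
have h : (N * m ^ d <= c * 4 ^ d * n ^ d)%N.
  apply: leq_trans (leq_mul (leqnn N) (expn_le_ffact sm)) _.
  rewrite mulnCA [X in (_ <= X)%N]mulnAC mulnC leq_mul2r.
  by rewrite (count_splits_ge double_weight_le ds sm) orbT.
rewrite -(ler_pM2r nd) expr_div_n -mulrA; move: h; rewrite -(ler_nat R) !natrM !natrX -pn.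
rewrite exprMn => h; have f0 : 0 < 4 ^+ d :> R by apply: exprn_gt0.
rewrite -(ler_pM2r f0); apply: le_trans (_ : N%:R * (p ^+ d * n%:R ^+ d) <= _).
  by rewrite le_eqVlt; apply/orP; left; apply/eqP; field; apply: lt0r_neq0.
by rewrite mulrAC.
Qed.

Lemma hyper_slice k (v : slice_fun R n m) : v \in @L R n m k ->
  S4 v <= (288 / p) ^+ k / #|{: slice n m}|%:R * dot v v ^+ 2.
Proof.
move=> vL; have mn : (m <= n)%N.
  by apply: leq_trans double_weight_le; rewrite leq_pmull.
set N := #|{: slice n m}|%:R; have N0 : 0 < N :> R by apply: card_slice_gt0.
have q1 : 1 <= 36 / p by rewrite ler_pdivlMr // mul1r; have := p_le; lra.
(* Per degree: 8 from [hyper_L], 9 from [hyper_level], and 4 / p from the count of splitting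
   points. *)
have -> : 288 / p = 8 * (36 / p) by field; apply: lt0r_neq0.
rewrite exprMn -[_ / N]mulrA; apply: (hyper_L _ _ vL).
  by rewrite divr_ge0 ?(ltW N0) // exprn_ge0 // (le_trans ler01).
move=> d w dk dm wL Lw; have c0 : 0 < N * (p / 4) ^+ d.
  by rewrite mulr_gt0 // exprn_gt0 // divr_gt0.
have h := @hyper_level R n m d _ c0 _ _ d [::] w isT erefl _ _.
rewrite -(ler_pM2l c0); apply: le_trans (h _ _ _ _) _.
- by apply: leq_trans double_weight_le; rewrite leq_mul2l.
- by move=> s ds sd; rewrite -sd; apply: count_splits_lower; rewrite ?sd.
- by [].
- by rewrite /= cardsT card_ord.
rewrite [leRHS]mulrA ler_wpM2r ?sqr_ge0 //.
apply: le_trans (_ : N * (p / 4) ^+ d * ((36 / p) ^+ d / N) <= _).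
  rewrite -mulrA [X in N * X]mulrA -exprMn [N * _]mulrC mulfVK ?gt_eqF //.
  have -> : p / 4 * (36 / p) = 9 by field; apply: lt0r_neq0.
  exact: lexx.
rewrite ler_wpM2l ?(ltW c0) // ler_wpM2r ?invr_ge0 ?(ltW N0) //.
exact: ler_weXn2l.
Qed.

Variables (k : nat) (eps : R).
Hypotheses (k_gt0 : (0 < k)%N) (eps_ge0 : 0 <= eps) (eps_le : eps <= p ^+ (22 * k)).

Let x := p ^+ k.
Let z : R := 2 ^+ k.

Let x_gt0 : 0 < x. Proof. exact: exprn_gt0. Qed.
Let z_gt0 : 0 < z. Proof. exact: exprn_gt0. Qed.

Let zx_le1 : z * x <= 1.
Proof.
by rewrite -exprMn exprn_ile1 ?mulr_ge0 ?(ltW p_gt0) //; have := p_le; lra.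
Qed.

Let x_half : x <= 1 / 2.
Proof.
apply: le_trans p_le; rewrite /x -(prednK k_gt0) exprS ler_piMr ?(ltW p_gt0) //.
by rewrite exprn_ile1 ?(ltW p_gt0) //; have := p_le; lra.
Qed.

Let eps_x : eps <= x ^+ 22. Proof. by rewrite -exprM mulnC. Qed.

Lemma rounding_threshold (N : R) : 0 < N ->
  32 * ((288 / p) ^+ k / N) * (4 ^+ k.+2 * (N * eps)) <= 1.
Proof.
move=> N0; have -> : 32 * ((288 / p) ^+ k / N) * (4 ^+ k.+2 * (N * eps))
    = 512 * (1152 ^+ k / x * eps).
  have -> : 1152 = 288 * 4 :> R by rewrite -natrM.
  rewrite expr_div_n -/x !(exprS 4) exprMn; field.
  by rewrite (gt_eqF N0) (gt_eqF x_gt0).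
(* Constants are absorbed into powers of z = 2^k, and z x <= 1 since p <= 1/2. *)
have z9 : 512 <= z ^+ 9.
  have -> : 512 = 2 ^+ 9 :> R by rewrite -natrX.
  by rewrite ler_pXn2r ?nnegrE ?(ltW z_gt0) // /z ler_eXnr // ler1n.
have z11 : 1152 ^+ k <= z ^+ 11.
  rewrite /z -exprM mulnC exprM ler_pXn2r ?nnegrE ?exprn_ge0 //.
  by rewrite -natrX ler_nat.
apply: le_trans (_ : z ^+ 9 * (z ^+ 11 / x * x ^+ 22) <= _).
  have q0 : 0 <= 1152 ^+ k / x by rewrite divr_ge0 ?(ltW x_gt0) ?exprn_ge0 ?ler0n.
  apply: (ler_pM _ _ z9); [exact: ler0n|exact: mulr_ge0|].
  by apply: (ler_pM q0 eps_ge0 _ eps_x); rewrite ler_pM2r // invr_gt0.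
have -> : z ^+ 9 * (z ^+ 11 / x * x ^+ 22) = (z * x) ^+ 20 * x.
  by field; rewrite gt_eqF.
have zx0 : 0 <= z * x by rewrite mulr_ge0 ?(ltW x_gt0) ?(ltW z_gt0).
apply: mulr_ile1; [exact: exprn_ge0|exact: ltW|exact: exprn_ile1|].
by have := x_half; lra.
Qed.

Lemma boolean_threshold (N : R) : 0 < N ->
  (288 / p) ^+ (k + k) / N * (2 * (N * eps)) < 1.
Proof.
move=> N0; have -> : (288 / p) ^+ (k + k) / N * (2 * (N * eps))
    = 2 * (288 ^+ k / x * (288 ^+ k / x) * eps).
  rewrite exprD expr_div_n -/x; field.
  by rewrite (gt_eqF N0) (gt_eqF x_gt0).
have z9 : 288 ^+ k <= z ^+ 9.
  rewrite /z -exprM mulnC exprM ler_pXn2r ?nnegrE ?exprn_ge0 //.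
  by rewrite -natrX ler_nat.
have q0 : 0 <= 288 ^+ k / x by rewrite divr_ge0 ?(ltW x_gt0) ?exprn_ge0 ?ler0n.
have qz : 288 ^+ k / x <= z ^+ 9 / x by rewrite ler_pM2r // invr_gt0.
apply: le_lt_trans (_ : 2 * (z ^+ 9 / x * (z ^+ 9 / x) * x ^+ 22) < 1).
  rewrite ler_pM2l //; apply: (ler_pM _ eps_ge0 _ eps_x); first exact: mulr_ge0.
  exact: ler_pM.
have -> : z ^+ 9 / x * (z ^+ 9 / x) * x ^+ 22 = (z * x) ^+ 18 * x ^+ 2.
  by field; rewrite gt_eqF.
apply: le_lt_trans (_ : 2 * (1 * (1 / 2) ^+ 2) < 1); last by lra.
rewrite ler_pM2l //; apply: ler_pM; rewrite ?sqr_ge0 //.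
- by rewrite exprn_ge0 // mulr_ge0 ?(ltW x_gt0) ?(ltW z_gt0).
- by rewrite exprn_ile1 // mulr_ge0 ?(ltW x_gt0) ?(ltW z_gt0).
- by rewrite ler_pXn2r ?nnegrE ?(ltW x_gt0) //; lra.
Qed.

End SliceConstants.

Theorem theorem1p4 (R : realType) :
  exists C : R,
  forall (p : R) (n k m : nat) (f : slice n m -> bool) (eps : R),
    0 < p -> p <= 1 / 2 ->
    (0 < n)%N -> (0 < k)%N ->
    p * n%:R = m%:R ->
    norm2_sq (above k (real_of_bool_fun R f)) <= eps ->
    eps <= p `^ (C * k%:R) ->
    exists f' : slice n m -> bool,
      degree_le k (real_of_bool_fun R f') /\
      prob R [pred x | f x != f' x] <= 2 * eps.
Proof.
(* With x = p^k and z = 2^k, the thresholds ask that eps z^20 / x and 2 eps z^18 / x^2 be small; as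
   z <= 1 / x, the exponent 22 leaves a spare factor x, respectively x^2. *)
exists 22 => p n k m f eps p0 p2 n0 k0 pn he.
rewrite -natrM powR_mulrn ?(ltW p0) // => epsp.
have mn : (m <= n)%N.
  by apply: leq_trans (double_weight_le p2 pn); rewrite leq_pmull.
set g := real_of_bool_fun R f in he *.
pose N : R := #|{: slice n m}|%:R; have N0 : 0 < N by apply: card_slice_gt0.
have normE (u : slice_fun R n m) : norm2_sq u = dot u u / N by [].
have eps0 : 0 <= eps.
  by apply: le_trans he; rewrite normE divr_ge0 ?dot_ge0 ?(ltW N0).
have [lowL highP] := aboveP mn k g.
have ng : near k (N * eps) g.
  exists (g - above k g), (above k g); split=> //; first by rewrite subrK.
  by move: he; rewrite normE ler_pdivrMr // mulrC.
have ig : intf g by move=> x; rewrite ffunE rpred_nat.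
have K0 l : 0 <= (288 / p) ^+ l / N.
  by rewrite divr_ge0 ?(ltW N0) // exprn_ge0 // divr_ge0 // ltW.
have hK l := @hyper_slice R p n m p0 p2 n0 pn l.
have [W [WL iW hW]] := integral_near_L (K0 k) (hK k) ig ng
  (rounding_threshold p0 p2 k0 eps0 epsp N0).
have Wbool := boolean_of_close (hK (k + k)%N) WL iW hW
  (boolean_threshold p0 p2 k0 eps0 epsp N0) (K0 _).
exists (fun x => W x == 1).
have WE : real_of_bool_fun R (fun x => W x == 1) = W.
  by apply/ffunP => x; rewrite ffunE -Wbool.
split; first by rewrite /degree_le WE.
rewrite /prob ler_pdivrMr // -/N.
have -> : 2 * eps * N = 2 * (N * eps) by ring.
(* At each disagreement the integer-valued difference of f and W is nonzero, so its squared norm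
   bounds their number. *)
apply: le_trans hW; apply: le_trans (card_supp_le (intfB ig iW)).
rewrite ler_nat; apply/subset_leq_card/subsetP => x; rewrite !inE.
rewrite -{2}WE /g !ffunE; case: (f x); case: (W x == 1) => //= _.
  by rewrite subr0 oner_eq0.
by rewrite sub0r oppr_eq0 oner_eq0.
Qed.
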